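(* Let $N\in\mathbb{N}$, $N\geq1$, and let $X[\mathcal{S}_N]$ be the Schreier space of order $N$. There is a family $(I_A)_{A\subset\mathbb{R}}$ of small closed operator ideals on $X[\mathcal{S}_N]$, indexed by all subsets of $\mathbb{R}$, such that for any $A,B\subset\mathbb{R}$, $$I_A\subset I_B\iff A\subset B.$$ In particular there are exactly $2^{\mathfrak{c}}$ distinct small closed operator ideals on $X[\mathcal{S}_N]$. There is also a chain (with respect to inclusion) of cardinality $\mathfrak{c}$ of small closed operator ideals on $X[\mathcal{S}_N]$, and an antichain (with respect to inclusion) of cardinality $2^{\mathfrak{c}}$ of small closed operator ideals on $X[\mathcal{S}_N]$.
   Context: Scalars are real; $\mathfrak{c}$ is the cardinality of the continuum. Schreier families of finite subsets of $\{1,2,\dots\}$ are defined inductively: $\mathcal{S}_0=\{\{n\}:n\ge1\}\cup\{\emptyset\}$ and, for $N\ge0$, $\mathcal{S}_{N+1}$ consists of $\emptyset$ and all unions $\bigcup_{i=1}^kE_i$ with $k\ge1$, $E_1,\dots,E_k\in\mathcal{S}_N$ non-empty, $E_1<\dots<E_k$ (i.e. $\max E_i<\min E_{i+1}$) and $k\le\min E_1$. The Schreier space $X[\mathcal{S}_N]$ is the completion of $c_{00}$ (finitely supported sequences) with the norm $\|(x_n)_n\|_{\mathcal{S}_N}=\sup_{\emptyset\ne A\in\mathcal{S}_N}\sum_{n\in A}|x_n|$. $\mathscr{B}(X)$ is the algebra of bounded linear operators on a Banach space $X$. An operator ideal on $X$ is a linear subspace of $\mathscr{B}(X)$ which is a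 two-sided ideal of the algebra $\mathscr{B}(X)$ and contains all finite-rank operators; it is closed if it is closed in the operator norm. $T\in\mathscr{B}(X)$ is strictly singular if no restriction of $T$ to an infinite-dimensional subspace is an isomorphism onto its image; $\mathscr{S}(X)$ is the set of strictly singular operators on $X$. An operator ideal on $X$ is small if it is contained in $\mathscr{S}(X)$. *)

(* Defs.v *)
From HB Require Import structures.
From mathcomp Require Import all_boot all_order all_algebra.
From mathcomp Require Import finmap.
From mathcomp Require Import all_classical all_reals all_analysis.

Set Implicit Arguments.
Unset Strict Implicit.
Unset Printing Implicit Defensive.

Import Order.TTheory GRing.Theory Num.Theory.
Import numFieldNormedType.Exports.

Local Open Scope classical_set_scope.
Local Open Scope ring_scope.

(** * Schreier spaces *)

(* [max E < min F], for non-empty [E] and [F]. *)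
Definition fset_before (E F : {fset nat}) : bool :=
  all (fun i => all (fun j => (i < j)%N) F) E.

(* The members are finite sets of positive integers. In the inductive step
   [Es = [:: E_1; ...; E_k]], and the last hypothesis is [k <= min E_1]. *)
Fixpoint schreier (N : nat) : set {fset nat} :=
  match N with
  | 0%N => [set A | A = fset0 \/ exists2 n : nat, (0 < n)%N & A = [fset n]%fset]
  | M.+1 => [set A | A = fset0 \/ exists Es : seq {fset nat},
      [/\ (0 < size Es)%N,
          forall E, E \in Es -> schreier M E /\ E != fset0,
          sorted fset_before Es,
          forall n, n \in head fset0 Es -> (size Es <= n)%N
        & A = (\bigcup_(E <- Es) E)%fset]]
  end.

Section SchreierSpace.
Variable R : realType.

(* A sequence [(x_n)_(n >= 1)] is a function on [nat] that vanishes at 0. *)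
Definition c00 : set (nat -> R) :=
  [set x | x 0%N = 0 /\ finite_set [set n | x n != 0]].

Definition schreier_norm (N : nat) (x : nat -> R) : R :=
  sup [set \sum_(n <- A) `|x n| | A in [set A | schreier N A /\ A != fset0]].

(* [X], a Banach space, is a completion of [c00] in the Schreier norm of
   order [N] by means of the embedding [iota]; the values of [iota] outside
   [c00] are irrelevant. *)
Definition is_schreier_space (N : nat) (X : completeNormedModType R)
    (iota : (nat -> R) -> X) : Prop :=
  [/\ forall (a : R) x y, c00 x -> c00 y ->
        iota (fun n => a * x n + y n) = a *: iota x + iota y,
      forall x, c00 x -> `|iota x| = schreier_norm N x
    & dense (iota @` c00)].

End SchreierSpace.

(** * Operators and operator ideals on a normed space *)

Definition linear_subspace (R : realType) (V : lmodType R) (Y : set V) : Prop :=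
  Y 0 /\ forall (a : R) u v, Y u -> Y v -> Y (a *: u + v).

Section Operators.
Variables (R : realType) (X : normedModType R).
Implicit Types (T S U : X -> X) (Y : set X) (I : set (X -> X)).

Definition bounded_operator T : Prop :=
  linear T /\ exists M : R, forall x, `|T x| <= M * `|x|.

Definition opnorm T : R := sup [set `|T x| | x in [set x : X | `|x| <= 1]].

Definition finite_dimensional Y : Prop :=
  exists n (v : 'I_n -> X),
    Y `<=` [set \sum_(i < n) a i *: v i | a in [set: 'I_n -> R]].

Definition finite_rank T : Prop := finite_dimensional (range T).

(* As [T] is continuous, its restriction to [Y] is an isomorphism onto the
   image [T @` Y] if and only if it has a continuous inverse [G] there. *)
Definition isomorphism_on Y T : Prop :=
  exists2 G : X -> X, {within T @` Y, continuous G} &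
                      forall y, Y y -> G (T y) = y.

Definition strictly_singular T : Prop :=
  bounded_operator T /\
  forall Y, linear_subspace Y -> ~ finite_dimensional Y -> ~ isomorphism_on Y T.

Definition operator_ideal I : Prop :=
  [/\ I `<=` bounded_operator,
      linear_subspace I,
      forall S T U, bounded_operator S -> I T -> bounded_operator U ->
        I (S \o T \o U)
    & forall T, bounded_operator T -> finite_rank T -> I T].

Definition norm_closed I : Prop :=
  forall T, bounded_operator T ->
    (forall e : R, 0 < e -> exists2 S, I S & opnorm (T \- S) < e) -> I T.

Definition small_closed_ideal I : Prop :=
  [/\ operator_ideal I, norm_closed I & I `<=` strictly_singular].

End Operators.

(** * Chains and antichains for inclusion *)

Definition incl_chain (T : Type) (C : set (set T)) : Prop :=
  total_on C (fun A B => A `<=` B).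

Definition incl_antichain (T : Type) (C : set (set T)) : Prop :=
  forall A B, C A -> C B -> A `<=` B -> A = B.

(* Main.v *)
Require Import Defs.
From mathcomp Require Import all_boot all_order all_algebra.
From mathcomp Require Import finmap.
From mathcomp Require Import all_classical all_reals all_analysis.
From mathcomp Require Import zify ring lra.
Set Implicit Arguments.
Unset Strict Implicit.
Unset Printing Implicit Defensive.
Import Order.TTheory GRing.Theory Num.Theory.
Import numFieldNormedType.Exports.
Local Open Scope classical_set_scope.
Local Open Scope ring_scope.
Local Open Scope card_scope.

(** Let [f_k] be the coordinate functionals of the Schreier space [X] and [e_k]
its unit vectors. Every operator below is measured by finitely many families of
coordinates. For a set [F] of subsets of [nat], [coord_ideal F] consists of the
bounded operators [T] such that for every [e > 0] there are finitely many
bounded operators [V_i], sets [D_i] that are members of [F] or equal to [{1}],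
and a constant [C] with
   [|T x| <= C t + e |x|]  whenever  [|f_k (V_i x)| <= t] for all [i], [k in D_i].
A condition of this shape passes to sums, to products with bounded operators
and to norm limits, and the sets [{1}] let in the finite-rank operators, because
[f_1] composed with [g(.) e_1] is the functional [g]. So [coord_ideal F] is a
closed ideal ([coord_ideal_operator_ideal], [coord_ideal_closed]).

It is small. If such a [T] were bounded below on an infinite-dimensional [Y],
then [|y| <= C sup_(i,k) |f_k (V_i y)|] would hold on [Y]. A gliding hump gives
unit vectors [y_1, ..., y_n] of [Y] such that, for each [i], the vectors [V_i y_j]
have almost disjoint coordinates beyond [n]. Sums of the [y_j] then stay bounded,
whereas one [V_i] sends the sum of at least [n / m] of them to a vector with as
many large coordinates beyond [n]; such coordinates form a Schreier set, so its
norm is of order [n / m] ([no_coord_domination]).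

Two sequences of blocks produce many different ideals, both of them repeated
averages ([block_sequences]): non-negative vectors with coordinate sum 1,
supported in successive intervals and smaller and smaller in a Schreier norm.
- Averages that are small for the order [N - 1] and supported in sets of order
  [N] span a copy of [c_0] with basis [u_k] ([c0_sequence_exists]). Hence
  [diag u D : x |-> sum_(k in D) f_k(x) u_k] is an operator, and it lies in
  [coord_ideal F] as soon as [D] is in [F].
- Averages [v_i] that are small for the order [N] live in intervals
  [(p_i, p_(i+1)]]; a set [Q] of indices determines the union [windows Q] of the
  intervals with index in [Q].
If [S] is infinite and meets each member of [F] in a finite set, then
[diag u (windows S)] is not in [coord_ideal (windows @` F)]: otherwise, for all
large [i] in [S], each [e_n] with [n] in the [i]-th interval would be sent by some
[V_j] to a vector with a large coordinate outside this interval. Of the mass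
[sum_n v_i(n) = 1], each single coordinate [k <= p_i] can account only for a
multiple of [|v_i|], and so can all the coordinates [k > p_(i+1)] together, for
these are few enough to form a Schreier set. That is at most
[C (p_i + 1) |v_i|], which tends to 0 ([diag_notin_coord_ideal]).

An almost disjoint family of infinite sets of naturals indexed by the reals,
here the codes of the graphs of [n |-> floor (n r)], turns this into a family
of ideals [I_A] ordered like the subsets [A] of the reals. Chains and antichains
of subsets give chains and antichains of ideals. There are no more than
[2^c] ideals because an operator is determined by the countably many reals
[f_k (T e_n)]. *)

(** * Combinatorics of Schreier families *)

Lemma increasing_leq (p : nat -> nat) : (forall i, (p i < p i.+1)%N) ->
  {homo p : i j / (i <= j)%N}.
Proof.
by move=> pS; apply: homo_leq => // [|i]; [exact: leq_trans|exact: ltnW].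
Qed.

Lemma increasing_ge_id (p : nat -> nat) i : (forall i, (p i < p i.+1)%N) -> (i <= p i)%N.
Proof. by move=> pS; elim: i => // i /leq_ltn_trans; apply. Qed.

Lemma window_uniq (p : nat -> nat) k i j : (forall i, (p i < p i.+1)%N) ->
  (p i < k <= p i.+1)%N -> (p j < k <= p j.+1)%N -> i = j.
Proof.
move=> pS /andP[ik ki] /andP[jk kj].
have [ij|ij|//] := ltngtP i j; have := increasing_leq pS ij; lia.
Qed.

Lemma in_bigfcup (Es : seq {fset nat}) n :
  reflect (exists2 E, E \in Es & n \in E) (n \in (\bigcup_(E <- Es) E)%fset).
Proof.
apply: (iffP (bigfcupP _ _ _ _)) => [[E /andP[EEs _] nE]|[E EEs nE]]; first by exists E.
by exists E => //; rewrite EEs.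
Qed.

Lemma schreier_gt0 N A n : schreier N A -> n \in A -> (0 < n)%N.
Proof.
elim: N A => [|N IH] A /=.
  by case=> [->|[m m0 ->]]; rewrite inE // => /eqP ->.
case=> [->|[Es [_ EsP _ _ ->]]]; first by rewrite inE.
by case/in_bigfcup => E /EsP[EN _]; exact: IH.
Qed.

Lemma schreierS N A : schreier N A -> schreier N.+1 A.
Proof.
move=> AN; have [->|A0] := eqVneq A fset0; first by left.
right; exists [:: A]; split => //=.
- by move=> E; rewrite inE => /eqP ->.
- by move=> n; exact: schreier_gt0 AN.
- by rewrite big_seq1.
Qed.

Lemma schreier_fset0 N : schreier N fset0.
Proof. by case: N => [|N]; left. Qed.

Lemma schreier_fset1 N n : (0 < n)%N -> schreier N [fset n]%fset.
Proof.
by move=> n0; elim: N => [|N]; [right; exists n|exact: schreierS].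
Qed.

(** Already the family of order 1 contains these sets, as unions of singletons. *)
Lemma schreier_few N (A : {fset nat}) : (0 < N)%N ->
  (forall n, n \in A -> (#|` A| <= n)%N) -> schreier N A.
Proof.
case: N => // N _ AP; elim: N => [|N]; last exact: schreierS.
have [->|A0] := eqVneq A fset0; first exact: schreier_fset0.
right; exists [seq [fset n]%fset | n <- sort leq A].
have sA : size (sort leq A) = #|` A| by rewrite size_sort cardfE.
have A_gt0 : (0 < #|` A|)%N by rewrite cardfs_gt0.
split.
- by rewrite size_map sA.
- move=> E /mapP[n]; rewrite mem_sort => nA ->; split; last first.
    by apply/fset0Pn; exists n; rewrite inE.
  by right; exists n => //; exact: leq_trans A_gt0 (AP _ nA).
- rewrite sorted_map.
  have : sorted ltn (sort leq A).
    rewrite ltn_sorted_uniq_leq sort_uniq fset_uniq /=.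
    by apply: sort_sorted; exact: leq_total.
  apply: sub_sorted => m n /= mn; apply/allP => i; rewrite inE => /eqP ->.
  by apply/allP => j; rewrite inE => /eqP ->.
- have := mem_sort leq A; case: (sort leq A) sA => [|a s] //= sA sE n.
  rewrite inE => /eqP ->; rewrite size_map sA; apply: AP.
  by rewrite -sE inE eqxx.
- apply/fsetP => n; apply/idP/in_bigfcup => [nA|[E /mapP[m]]].
    by exists [fset n]%fset; rewrite ?inE //; apply/mapP; exists n; rewrite ?mem_sort.
  by rewrite mem_sort => mA ->; rewrite inE => /eqP ->.
Qed.

(** The number of pieces is bounded by every element of the union, and not only
    by those of the first piece: successive pieces lie to the right of it. *)
Lemma schreierS_cover N A : schreier N.+1 A -> exists Es : seq {fset nat},
  [/\ forall E, E \in Es -> schreier N E,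
      forall n, n \in A -> (size Es <= n)%N
    & A = (\bigcup_(E <- Es) E)%fset].
Proof.
case=> [->|[Es [Es0 EsP Es_sorted Es_head AE]]].
  by exists [::]; split=> //; rewrite big_nil.
exists Es; split => // [E /EsP[]//|n]; rewrite AE => /in_bigfcup[F FEs nF].
case: Es Es0 EsP Es_sorted Es_head FEs {AE} => //= E Es _ EsP Es_sorted Es_head.
rewrite inE => /orP[/eqP FE|FEs]; first by apply: Es_head; rewrite -FE.
have /fset0Pn[m mE] : E != fset0 by case: (EsP E); rewrite ?inE ?eqxx.
have fset_before_trans : {in [pred G | G != fset0] & &, transitive fset_before}.
  move=> G1 G2 G3 /fset0Pn[a aG1] _ _ /allP G21 /allP G13.
  apply/allP => i iG2; apply/allP => j jG3.
  exact: ltn_trans (allP (G21 _ iG2) _ aG1) (allP (G13 _ aG1) _ jG3).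
have := Es_sorted; rewrite (path_sorted_inE fset_before_trans); last first.
  by apply/allP => G GEs; case: (EsP G).
case/andP=> /allP/(_ _ FEs)/allP/(_ _ mE)/allP/(_ _ nF) mn _.
exact: leq_trans (Es_head _ mE) (ltnW mn).
Qed.

(** * Repeated averages *)

Section Sums.
Context {R : realType}.

Lemma ler_sum_uniq_sub (I : eqType) (s t : seq I) (x : I -> R) :
  uniq s -> {subset s <= t} -> (forall i, 0 <= x i) ->
  \sum_(i <- s) x i <= \sum_(i <- t) x i.
Proof.
move=> us st x0; elim: s t us st => [|i s IH] t /=.
  by rewrite big_nil sumr_ge0.
case/andP=> is_ us st; have it : i \in t by rewrite st ?inE ?eqxx.
rewrite big_cons [leRHS](big_rem i) //= lerD2l.
apply: IH => // j js; have /st : j \in i :: s by rewrite inE js orbT.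
have ji : j != i by apply: contraNneq is_ => <-.
by rewrite (perm_mem (perm_to_rem it)) inE (negPf ji).
Qed.

Lemma sum_supported (I : choiceType) (A E : {fset I}) (x : I -> R) :
  (forall i, 0 <= x i) -> (forall i, i \notin E -> x i = 0) ->
  \sum_(i <- A) x i <= \sum_(i <- E) x i.
Proof.
move=> x0 xE; rewrite (bigID (mem E)) /= [X in _ + X]big1 ?addr0 //.
rewrite -big_filter; apply: ler_sum_uniq_sub => //.
  by rewrite filter_uniq // fset_uniq.
by move=> i; rewrite mem_filter => /andP[].
Qed.

Lemma ler_sum_cover (Es : seq {fset nat}) (x : nat -> R) :
  (forall i, 0 <= x i) ->
  \sum_(i <- (\bigcup_(E <- Es) E)%fset) x i <= \sum_(E <- Es) \sum_(i <- E) x i.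
Proof.
move=> x0; rewrite (_ : \sum_(E <- Es) _ =
    \sum_(i <- flatten [seq enum_fset E | E <- Es]) x i); last first.
  by rewrite big_flatten big_map.
apply: ler_sum_uniq_sub => // i /in_bigfcup[E EEs iE].
by apply/flattenP; exists (enum_fset E) => //; exact: map_f.
Qed.

Lemma sum_at_most_one m (b : nat -> bool) :
  (forall i j, b i -> b j -> i = j) -> \sum_(i < m) (b i)%:R <= 1 :> R.
Proof.
move=> b1; have [[i bi]|nb] := pselect (exists i : 'I_m, b i); last first.
  rewrite big1 // => i _; case bi: (b i) => //.
  by exfalso; apply: nb; exists i.
rewrite (bigD1 i) //= bi big1 ?addr0 // => j ji; case bj: (b j) => //.
by case/eqP: ji; apply/val_inj/b1.
Qed.

Lemma sum_halves m : \sum_(i < m) (2 ^- i.+1 : R) <= 1.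
Proof.
suff -> : \sum_(i < m) (2 ^- i.+1 : R) = 1 - 2 ^- m.
  by rewrite gerBl invr_ge0 exprn_ge0.
elim: m => [|m IH]; first by rewrite big_ord0 expr0 invr1 subrr.
rewrite big_ord_recr IH /= exprS; have : (2 ^+ m : R) != 0 by rewrite expf_neq0.
by move=> m0; field.
Qed.

End Sums.

Section Blocks.
Context {R : realType}.
Implicit Types (M : nat) (A : {fset nat}).

Definition schreier_average M (eps : R) (E : {fset nat}) (v : nat -> R) :=
  [/\ schreier M.+1 E, forall n, 0 <= v n, forall n, n \notin E -> v n = 0,
      \sum_(n <- E) v n = 1
    & forall A, schreier M A -> \sum_(n <- A) v n <= eps].

(** The repeated averages, one order at a time. *)
Definition averages_exist M := forall K (eps : R), 0 < eps ->
  exists E v, (forall n, n \in E -> (K < n)%N) /\ schreier_average M eps E v.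

(** The bound decays so fast that even [p i] sets of order [M] see almost nothing
    of the blocks from the [i]-th one on. *)
Definition block_sequence M (p : nat -> nat) (E : nat -> {fset nat})
    (v : nat -> nat -> R) := forall i,
  [/\ (p i < p i.+1)%N, forall n, n \in E i -> (p i < n <= p i.+1)%N
    & schreier_average M (2 ^- i.+1 / (p i).+1%:R) (E i) (v i)].

Lemma schreier_average_le1 M eps E v A :
  schreier_average M eps E v -> \sum_(n <- A) v n <= 1.
Proof. by case=> _ v0 vE <- _; exact: sum_supported. Qed.

Lemma block_sequence_lt M p E v : block_sequence M p E v ->
  forall i, (p i < p i.+1)%N.
Proof. by move=> bs i; case: (bs i). Qed.

Lemma block_sequence_exists M : averages_exist M ->
  exists p E v, block_sequence M p E v.
Proof.
move=> avgM.
have step (s : nat * nat) : exists Ev : {fset nat} * (nat -> R),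
    (forall n, n \in Ev.1 -> (s.2 < n)%N) /\
    schreier_average M (2 ^- s.1.+1 / s.2.+1%:R) Ev.1 Ev.2.
  have [|E [v Ev]] := avgM s.2 (2 ^- s.1.+1 / s.2.+1%:R).
    by rewrite divr_gt0 // invr_gt0 exprn_gt0.
  by exists (E, v).
have {step}[g gP] := choice step.
pose next s := maxn s.2.+1 (\max_(n <- (g s).1) n).
pose p := fix p i := if i is j.+1 then next (j, p j) else 0%N.
exists p, (fun i => (g (i, p i)).1), (fun i => (g (i, p i)).2) => i.
have [gp gavg] := gP (i, p i); split => //=.
  by rewrite /next leq_max ltnSn.
move=> n nE; rewrite gp //= /next leq_max; apply/orP; right.
exact: leq_bigmax_seq.
Qed.

(** A set of order [M.+1] made of [k] pieces of order [M] lies beyond [k].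
    If [k <= p i], the smallness of the block beats the number of pieces; if
    [k > p i.+1], the set misses the block. Only the block whose window contains [k]
    is left, and there the trivial bound 1 is used. *)
Lemma block_sum_le M p E v A i k : block_sequence M p E v ->
  (forall n, n \in A -> (k <= n)%N) ->
  (exists2 Es : seq {fset nat}, forall F, F \in Es -> schreier M F &
    size Es = k /\ A = (\bigcup_(F <- Es) F)%fset) ->
  \sum_(n <- A) v i n <= (p i < k <= p i.+1)%N%:R + 2 ^- i.+1.
Proof.
move=> bs kA [Es EsP [sEs AE]]; have [pp Ep avg] := bs i.
have h0 : 0 <= (2 ^- i.+1 : R) by rewrite invr_ge0 exprn_ge0.
have [ki|ik] := leqP k (p i) => /=.
  rewrite add0r AE; case: avg => _ v0 _ _ vM.
  apply: le_trans (ler_sum_cover _ v0) _.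
  apply: (@le_trans _ _ (\sum_(F <- Es) 2 ^- i.+1 / (p i).+1%:R)).
    by rewrite big_seq [leRHS]big_seq; apply: ler_sum => F /EsP/vM.
  rewrite big_const_seq count_predT sEs iter_addr_0 -[leLHS]mulr_natr -mulrA ler_piMr //.
  by rewrite mulrC ler_pdivrMr // mul1r ler_nat leqW.
case: leqP => ki /=; last first.
  rewrite add0r big_seq big1 // => n nA; case: avg => _ _ vE _ _; apply: vE.
  by apply/negP => /Ep; have := kA _ nA; lia.
by apply: le_trans (schreier_average_le1 _ avg) _; rewrite lerDl.
Qed.

(** A set of order [M.+1] sees one block fully and the others by a total of at
    most 1. This makes the blocks equivalent to the unit vectors of [c_0] in the
    norm of order [M.+1]. *)
Lemma block_sequence_c0 M p E v m A : block_sequence M p E v ->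
  schreier M.+1 A -> \sum_(i < m) \sum_(n <- A) v i n <= 2.
Proof.
move=> bs /schreierS_cover[Es [EsP kA AE]].
apply: (@le_trans _ _ (\sum_(i < m) ((p i < size Es <= p i.+1)%N%:R + 2 ^- i.+1))).
  apply: ler_sum => i _; apply: (block_sum_le _ bs) => //.
  by exists Es.
rewrite big_split /= -[2]/(1 + 1); apply: lerD; last exact: sum_halves.
apply: (@sum_at_most_one _ m (fun i => p i < size Es <= p i.+1)%N) => i j.
exact: window_uniq (block_sequence_lt bs).
Qed.

(** The average of [m] successive blocks of order [M] is supported in a set of
    order [M.+2] if the blocks start beyond [m], and by [block_sequence_c0] its
    sums over sets of order [M.+1] are at most [2 / m]. *)
Lemma averages_exist_all M : averages_exist M.
Proof.
elim: M => [|M IH] K eps eps0.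
  (* Order 0: the sums over singletons of a flat average of [m] unit vectors
     placed from [m] on are [1 / m]. *)
  pose m := (maxn K (Num.trunc eps^-1)).+1.
  have m0 : (0 < m%:R :> R) by rewrite ltr0n.
  pose E : {fset nat} := seq_fset tt (iota m m).
  have cE : #|` E| = m.
    by rewrite size_seq_fset undup_id ?iota_uniq // size_iota.
  have inE' n : (n \in E) = (m <= n < m + m)%N by rewrite seq_fsetE mem_iota.
  exists E, (fun n => (n \in E)%:R / m%:R); split.
    by move=> n; rewrite inE' /m; lia.
  split.
  - by apply: schreier_few => // n; rewrite cE inE'; case/andP.
  - by move=> n; rewrite divr_ge0.
  - by move=> n /negPf ->; rewrite mul0r.
  - rewrite -mulr_suml big_seq (eq_bigr (fun=> 1)) => [|i ->//].
    rewrite -big_seq big_const_seq count_predT iter_addr_0 [size _]cE.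
    by rewrite divff // gt_eqF.
  - move=> A [->|[n _ ->]]; first by rewrite big_nil ltW.
    rewrite big_seq_fset1; apply: (@le_trans _ _ m%:R^-1).
      by apply: ler_piMl; [rewrite invr_ge0 ltW|case: (_ \in _)].
    rewrite invf_ple ?posrE //; apply/ltW/(lt_le_trans (truncnS_gt _)).
    by rewrite ler_nat /m ltnS leq_max leqnn orbT.
have [p [E [v bs]]] := block_sequence_exists IH.
pose m := (maxn K (Num.trunc (2 / eps))).+1.
have m0 : (0 < m%:R :> R) by rewrite ltr0n.
have p_leq := increasing_leq (block_sequence_lt bs).
pose Es := [seq E i | i <- iota m m].
pose F := (\bigcup_(G <- Es) G)%fset.
have FP n : n \in F -> (m < n)%N.
  case/in_bigfcup => G /mapP[i]; rewrite mem_iota => /andP[mi _] ->.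
  case: (bs i) => _ EP _ /EP /andP[+ _]; apply: leq_ltn_trans.
  by apply: leq_trans (p_leq _ _ mi); exact: increasing_ge_id (block_sequence_lt bs).
have EN0 i : E i != fset0.
  case: (bs i) => _ _ [_ _ _ + _]; apply: contra_eq_neq => ->.
  by rewrite big_nil eq_sym oner_neq0.
exists F, (fun n => (\sum_(i <- iota m m) v i n) / m%:R); split.
  by move=> n /FP; rewrite /m; lia.
split.
- right; exists Es; split=> //.
  + by move=> G /mapP[i _ ->]; split => //; case: (bs i) => _ _ [].
  + rewrite /Es sorted_map; have : sorted ltn (iota m m) by exact: iota_ltn_sorted.
    apply: sub_sorted => i j /= ij; apply/allP => a aE; apply/allP => b bE.
    case: (bs i) => _ /(_ _ aE) /andP[_ a1] _.
    case: (bs j) => _ /(_ _ bE) /andP[b1 _] _.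
    exact: leq_ltn_trans a1 (leq_ltn_trans (p_leq _ _ ij) b1).
  + move=> n nh; rewrite /Es size_map size_iota; apply/ltnW/FP/in_bigfcup.
    exists (E m); rewrite /Es /= ?inE ?eqxx //.
- move=> n; rewrite divr_ge0 // sumr_ge0 // => i _.
  by case: (bs i) => _ _ [].
- move=> n nF; rewrite big_seq big1 ?mul0r // => i im.
  case: (bs i) => _ _ [_ _ + _ _]; apply.
  apply: contra nF => nE; apply/in_bigfcup; exists (E i) => //.
  exact: map_f.
- rewrite -mulr_suml exchange_big /=.
  suff -> : \sum_(i <- iota m m) \sum_(n <- F) v i n = m%:R.
    by rewrite divff // gt_eqF.
  rewrite -[in RHS](size_iota m m) -sum1_size natr_sum.
  apply: eq_big_seq.
  move=> i im; case: (bs i) => _ _ [_ v0 vE v1 _].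
  rewrite -v1; apply/eqP; rewrite eq_le sum_supported //=.
  apply: ler_sum_uniq_sub => //; first exact: fset_uniq.
  move=> n nE; apply/in_bigfcup; exists (E i) => //.
  exact: map_f.
- move=> A AM; rewrite -mulr_suml ler_pdivrMr // exchange_big /=.
  apply: (@le_trans _ _ 2).
    apply: le_trans (block_sequence_c0 (m + m) bs AM).
    rewrite -(big_mkord xpredT (fun i => \sum_(n <- A) v i n)) /index_iota subn0.
    apply: (@ler_sum_uniq_sub _ _ (iota m m)) => [|i|i].
    + exact: iota_uniq.
    + by rewrite !mem_iota /=; lia.
    + by apply: sumr_ge0 => n _; case: (bs i) => _ _ [].
  rewrite mulrC -ler_pdivrMr //; apply/ltW/(lt_le_trans (truncnS_gt _)).
  by rewrite ler_nat /m ltnS leq_max leqnn orbT.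
Qed.

Lemma block_sequences M : exists p E v, block_sequence M p E v.
Proof. by apply/block_sequence_exists/averages_exist_all. Qed.

End Blocks.

(** * Coordinates on a Schreier space *)

Section FiniteSequences.
Context {R : realType}.
Implicit Types x y : nat -> R.

Definition unit_seq (k : nat) : nat -> R := fun n => (n == k)%:R.

Lemma c00_supported x (E : {fset nat}) :
  x 0%N = 0 -> (forall n, n \notin E -> x n = 0) -> c00 x.
Proof.
move=> x0 xE; split=> //; apply: (sub_finite_set _ (finite_fset E)) => n /=.
by move/eqP=> xn; apply/negPn/negP => /xE.
Qed.

Lemma c00_support x : c00 x -> exists E : {fset nat}, forall n, n \notin E -> x n = 0.
Proof.
case=> _ fx; exists (fset_set [set n | x n != 0]) => n.
by rewrite in_fset_set // notin_setE /= => /negP; rewrite negbK => /eqP.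
Qed.

Lemma c00_lin (a : R) x y : c00 x -> c00 y -> c00 (fun n => a * x n + y n).
Proof.
move=> cx cy; have [E xE] := c00_support cx; have [F yF] := c00_support cy.
apply: (@c00_supported _ (E `|` F)%fset).
  by rewrite cx.1 cy.1 mulr0 addr0.
move=> n; rewrite in_fsetU negb_or => /andP[nE nF].
by rewrite xE // yF // mulr0 addr0.
Qed.

Lemma c00_zero : c00 (fun=> 0 : R).
Proof. exact: (@c00_supported _ fset0). Qed.

Lemma c00_unit_seq k : (0 < k)%N -> c00 (unit_seq k).
Proof.
move=> k0; apply: (@c00_supported _ [fset k]%fset).
  by rewrite /unit_seq ltn_eqF.
by move=> n; rewrite inE /unit_seq => /negPf ->.
Qed.

Lemma c00_sum (I : eqType) (s : seq I) (b : I -> R) (u : I -> nat -> R) :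
  (forall i, i \in s -> c00 (u i)) -> c00 (fun n => \sum_(i <- s) b i * u i n).
Proof.
elim: s => [|i s IH] us.
  rewrite (_ : (fun n => _) = fun=> 0); first exact: c00_zero.
  by apply/funext => n; rewrite big_nil.
rewrite (_ : (fun n => _) = fun n => b i * u i n + \sum_(i <- s) b i * u i n).
  apply: c00_lin; first by apply: us; rewrite mem_head.
  by apply: IH => j js; apply: us; rewrite inE js orbT.
by apply/funext => n; rewrite big_cons.
Qed.

Lemma ler_schreier_norm N x A : c00 x -> schreier N A ->
  \sum_(n <- A) `|x n| <= schreier_norm N x.
Proof.
move=> cx AN; have [E xE] := c00_support cx.
have ub : has_ubound [set \sum_(n <- A) `|x n| | A in [set A | schreier N A /\ A != fset0]].
  exists (\sum_(n <- E) `|x n|) => _ [B _ <-]; apply: sum_supported => // n nE.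
  by rewrite xE // normr0.
have [->|A0] := eqVneq A fset0; last by apply: ub_le_sup => //; exists A.
rewrite big_nil; apply: le_trans (ub_le_sup ub _); last first.
  exists [fset 1%N]%fset => //; split; first exact: schreier_fset1.
  by apply/fset0Pn; exists 1%N; rewrite inE.
exact: sumr_ge0.
Qed.

Lemma schreier_norm_le N x (C : R) :
  (forall A, schreier N A -> \sum_(n <- A) `|x n| <= C) -> schreier_norm N x <= C.
Proof.
move=> xC; apply: sup_le_ub => [|_ [A [AN _] <-]]; last exact: xC.
eexists; exists [fset 1%N]%fset => //; split; first exact: schreier_fset1.
by apply/fset0Pn; exists 1%N; rewrite inE.
Qed.

End FiniteSequences.

Section Coordinates.
Context {R : realType} {N : nat} {X : completeNormedModType R}.
Context {iota : (nat -> R) -> X} (HX : is_schreier_space N iota).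

Lemma iotaD (a : R) x y : c00 x -> c00 y ->
  iota (fun n => a * x n + y n) = a *: iota x + iota y.
Proof. by case: HX => + _ _; apply. Qed.

Lemma iota0 : iota (fun=> 0) = 0.
Proof.
apply: (@addrI _ (iota (fun=> 0))); rewrite addr0 -{1}[iota _]scale1r -iotaD;
  try exact: c00_zero.
by congr iota; apply/funext => n; rewrite mulr0 addr0.
Qed.

Lemma iota_sum (I : eqType) (s : seq I) (b : I -> R) (u : I -> nat -> R) :
  (forall i, i \in s -> c00 (u i)) ->
  iota (fun n => \sum_(i <- s) b i * u i n) = \sum_(i <- s) b i *: iota (u i).
Proof.
elim: s => [|i s IH] us.
  rewrite big_nil -[RHS]iota0; congr iota.
  by apply/funext => n; rewrite big_nil.
rewrite big_cons -IH; last by move=> j js; apply: us; rewrite inE js orbT.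
rewrite -iotaD; last 2 first.
- by apply: us; rewrite mem_head.
- by apply: c00_sum => j js; apply: us; rewrite inE js orbT.
by congr iota; apply/funext => n; rewrite big_cons.
Qed.

Lemma iotaB x y : c00 x -> c00 y -> iota x - iota y = iota (fun n => x n - y n).
Proof.
move=> cx cy; rewrite -scaleN1r addrC -iotaD //; congr iota.
by apply/funext => n; rewrite mulN1r addrC.
Qed.

Lemma ler_norm_iota x A : c00 x -> schreier N A ->
  \sum_(n <- A) `|x n| <= `|iota x|.
Proof. by move=> cx AN; case: HX => _ -> // _; exact: ler_schreier_norm. Qed.

Lemma norm_iota_le x (C : R) : c00 x ->
  (forall A, schreier N A -> \sum_(n <- A) `|x n| <= C) -> `|iota x| <= C.
Proof. by move=> cx xC; case: HX => _ -> // _; exact: schreier_norm_le. Qed.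

Lemma iota_dense (x : X) (e : R) : 0 < e -> exists2 y, c00 y & `|x - iota y| < e.
Proof.
move=> e0; case: HX => _ _ /(_ (ball x e)) [].
- by exists x; exact: ballxx.
- exact: ball_open.
- by move=> z [xz [y cy yz]]; exists y => //; move: xz; rewrite -yz -ball_normE.
Qed.

Lemma ler_entry_iota x k : c00 x -> `|x k| <= `|iota x|.
Proof.
move=> cx; case: k => [|k]; first by rewrite cx.1 normr0.
by have := ler_norm_iota cx (schreier_fset1 N (ltn0Sn k)); rewrite big_seq_fset1.
Qed.

(** A 1-Lipschitz function on the dense subspace extends to the whole space by
    this infimum, which avoids limits; [coord_approx] gives all that is needed. *)
Definition coord k (x : X) : R := inf [set y k + `|x - iota y| | y in @c00 R].

Lemma coord_approx k (x : X) y : c00 y -> `|coord k x - y k| <= `|x - iota y|.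
Proof.
move=> cy; have lb z : c00 z -> y k - `|x - iota y| <= z k + `|x - iota z|.
  move=> cz; have cyz : c00 (fun n => y n - z n).
    rewrite (_ : (fun n => _) = fun n => -1 * z n + y n); first exact: c00_lin.
    by apply/funext => n; rewrite mulN1r addrC.
  have yz : `|y k - z k| <= `|iota y - iota z|.
    by rewrite iotaB //; exact: (ler_entry_iota k cyz).
  have := ler_norm (y k - z k).
  have := ler_distD x (iota y) (iota z); rewrite (distrC (iota y) x); lra.
rewrite ler_distl; apply/andP; split.
  apply: lb_le_inf; first by exists (y k + `|x - iota y|); exists y.
  by move=> _ [z cz <-]; exact: lb.
apply: ge_inf; last by exists y.
by exists (y k - `|x - iota y|) => _ [z cz <-]; exact: lb.
Qed.

Lemma coord_iota k y : c00 y -> coord k (iota y) = y k.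
Proof.
move=> cy; apply/eqP; rewrite -subr_eq0 -normr_le0.
by have := coord_approx k (iota y) cy; rewrite subrr normr0.
Qed.

(** Both sides are within [e] of the value at finite sequences that approximate
    [x] and [y] up to [d]. *)
Lemma coord_linear k (a : R) x y : coord k (a *: x + y) = a * coord k x + coord k y.
Proof.
apply/eqP; rewrite -subr_eq0 -normr_le0; apply/ler_addgt0Pl => e e0; rewrite addr0.
pose d := e / (2 * (`|a| + 1)).
have a0 : 0 < `|a| + 1 by rewrite ltr_wpDl.
have d0 : 0 < d by rewrite divr_gt0 // mulr_gt0.
have [u cu xu] := iota_dense x d0; have [v cv yv] := iota_dense y d0.
have h : `|coord k (a *: x + y) - (a * u k + v k)| <=
    `|a *: (x - iota u) + (y - iota v)|.
  have -> : a *: (x - iota u) + (y - iota v) =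
      (a *: x + y) - iota (fun n => a * u n + v n).
    by rewrite iotaD // scalerBr addrACA -opprD.
  exact: (coord_approx k _ (c00_lin a cu cv)).
have hu := coord_approx k x cu; have hv := coord_approx k y cv.
have h2 : `|a *: (x - iota u) + (y - iota v)| <= `|a| * d + d.
  apply: le_trans (ler_normD _ _) _; rewrite normrZ lerD //; last exact: ltW.
  by rewrite ler_wpM2l // ltW.
have -> : coord k (a *: x + y) - (a * coord k x + coord k y) =
  (coord k (a *: x + y) - (a * u k + v k)) - (a * (coord k x - u k) + (coord k y - v k)).
  by ring.
apply: le_trans (ler_normB _ _) _.
have h3 : `|a * (coord k x - u k) + (coord k y - v k)| <= `|a| * d + d.
  apply: le_trans (ler_normD _ _) _; rewrite normrM lerD //.
    by rewrite ler_wpM2l // (le_trans hu) // ltW.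
  by rewrite (le_trans hv) // ltW.
have -> : e = (`|a| * d + d) + (`|a| * d + d).
  rewrite /d; field; exact: lt0r_neq0.
by rewrite lerD // (le_trans h).
Qed.

Lemma coord0 k : coord k 0 = 0.
Proof. by rewrite -iota0 coord_iota //; exact: c00_zero. Qed.

Lemma coordD k x y : coord k (x + y) = coord k x + coord k y.
Proof. by have := coord_linear k 1 x y; rewrite scale1r mul1r. Qed.

Lemma coordZ k (a : R) x : coord k (a *: x) = a * coord k x.
Proof. by have := coord_linear k a x 0; rewrite !addr0 coord0 addr0. Qed.

Lemma coordB k x y : coord k (x - y) = coord k x - coord k y.
Proof. by rewrite coordD -scaleN1r coordZ mulN1r. Qed.

Lemma coord_sum k (I : Type) (s : seq I) (P : pred I) (F : I -> X) :
  coord k (\sum_(i <- s | P i) F i) = \sum_(i <- s | P i) coord k (F i).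
Proof. by apply: big_morph => [x y|]; [exact: coordD|exact: coord0]. Qed.

Lemma ler_sum_coord A x : schreier N A -> \sum_(k <- A) `|coord k x| <= `|x|.
Proof.
move=> AN; apply/ler_addgt0Pl => e e0.
have s0 : (0 < (#|` A|).+1%:R + 1 :> R) by rewrite ltr_wpDl.
pose d := e / ((#|` A|).+1%:R).
have d0 : 0 < d by rewrite divr_gt0.
have [u cu xu] := iota_dense x d0.
have h1 : \sum_(k <- A) `|coord k x| <= \sum_(k <- A) (d + `|u k|).
  apply: ler_sum => k _; have := coord_approx k x cu.
  have := ler_normD (coord k x - u k) (u k); rewrite subrK; lra.
apply: le_trans h1 _; rewrite big_split /= big_const_seq count_predT iter_addr_0.
have := ler_norm_iota cu AN; have := ler_normB (iota u) x.
have := ler_normD (iota u - x) x; rewrite subrK distrC => h2 _ h3.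
have -> : e = d + d *+ size A.
  by rewrite -mulrS -[RHS]mulr_natr /d divfK.
lra.
Qed.

Lemma ler_coord k x : `|coord k x| <= `|x|.
Proof.
case: k => [|k].
  rewrite (_ : coord 0 x = 0) ?normr0 //.
  apply/eqP; rewrite -normr_le0; apply/ler_addgt0Pl => e e0; rewrite addr0.
  have [u cu xu] := iota_dense x e0.
  by have := coord_approx 0 x cu; rewrite cu.1 subr0 => /le_trans; apply; apply: ltW.
by have := ler_sum_coord x (schreier_fset1 N (ltn0Sn k)); rewrite big_seq_fset1.
Qed.

Lemma coord_vanishes x (e : R) : 0 < e ->
  exists K, forall k, (K < k)%N -> `|coord k x| <= e.
Proof.
move=> e0; have [u cu xu] := iota_dense x e0; have [E uE] := c00_support cu.
exists (\max_(n <- E) n) => k Ek; have := coord_approx k x cu.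
rewrite uE ?subr0; first by move/le_trans; apply; exact: ltW.
by apply: contraL Ek => kE; rewrite -leqNgt; exact: leq_bigmax_seq.
Qed.

(** If all coordinates of [x] vanish, those of [iota u] are at most
    [|x - iota u|] in every Schreier sum, so [|iota u| <= |x - iota u|]. *)
Lemma coord_total x : (forall k, coord k x = 0) -> x = 0.
Proof.
move=> x0; apply/eqP; rewrite -normr_le0; apply/ler_addgt0Pl => e e0; rewrite addr0.
have e2 : 0 < e / 2 by rewrite divr_gt0.
have [u cu xu] := iota_dense x e2.
have : `|iota u| <= `|x - iota u|.
  apply: norm_iota_le => // A AN; apply: le_trans (ler_sum_coord (x - iota u) AN).
  by apply: ler_sum => k _; rewrite coordB x0 coord_iota // sub0r normrN.
have := ler_normD (x - iota u) (iota u); rewrite subrK; lra.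
Qed.

Definition basis k : X := iota (unit_seq k).

Lemma coord_basis j k : (0 < k)%N -> coord j (basis k) = (j == k)%:R.
Proof. by move=> k0; rewrite coord_iota //; exact: c00_unit_seq. Qed.

Lemma iota_basis x (E : {fset nat}) : c00 x -> (forall n, n \notin E -> x n = 0) ->
  (forall n, n \in E -> (0 < n)%N) -> iota x = \sum_(n <- E) x n *: basis n.
Proof.
move=> cx xE E0; rewrite -iota_sum => [|n nE]; last exact/c00_unit_seq/E0.
congr iota; apply/funext => n.
have [nE|nE] := boolP (n \in E).
  rewrite (big_fsetD1 n) //= /unit_seq eqxx mulr1 big_seq big1 ?addr0 // => i.
  by rewrite !inE eq_sym => /andP[/negPf -> _]; rewrite mulr0.
rewrite xE // big_seq big1 // => i iE; rewrite /unit_seq.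
by case: eqP iE nE => [-> ->//|_ _ _]; rewrite mulr0.
Qed.

End Coordinates.
Arguments coord {R X} iota k x.
Arguments basis {R X} iota k.

(** * Bounded operators and diagonal operators into a copy of [c_0] *)

Section Operators.
Context {R : realType} {X Y : normedModType R}.
Implicit Types T S : X -> Y.

Lemma lin_op0 T : linear T -> T 0 = 0.
Proof. by move=> lT; have := lT (-1) 0 0; rewrite !scaleN1r oppr0 addr0 addNr. Qed.

Lemma lin_opZ T (a : R) x : linear T -> T (a *: x) = a *: T x.
Proof. by move=> lT; have := lT a x 0; rewrite !addr0 (lin_op0 lT) addr0. Qed.

Lemma lin_opD T x y : linear T -> T (x + y) = T x + T y.
Proof. by move=> lT; have := lT 1 x y; rewrite !scale1r. Qed.

Lemma lin_opB T x y : linear T -> T (x - y) = T x - T y.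
Proof. by move=> lT; rewrite lin_opD // -scaleN1r lin_opZ // scaleN1r. Qed.

Lemma lin_op_sum T (I : Type) (s : seq I) (P : pred I) (F : I -> X) : linear T ->
  T (\sum_(i <- s | P i) F i) = \sum_(i <- s | P i) T (F i).
Proof.
by move=> lT; apply: big_morph => [x y|]; [exact: lin_opD|exact: lin_op0].
Qed.

End Operators.

Section BoundedOperators.
Context {R : realType} {X : normedModType R}.
Implicit Types T S : X -> X.

Lemma bounded_operator_gt0 T : bounded_operator T ->
  exists2 M : R, 0 < M & forall x, `|T x| <= M * `|x|.
Proof.
case=> _ [M TM]; exists (Num.max M 1); first by rewrite lt_max ltr01 orbT.
by move=> x; apply: le_trans (TM x) _; rewrite ler_wpM2r // le_max lexx.
Qed.

Lemma bounded_operator_comp S T :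
  bounded_operator S -> bounded_operator T -> bounded_operator (S \o T).
Proof.
move=> bS bT; have [M M0 SM] := bounded_operator_gt0 bS.
have [K K0 TK] := bounded_operator_gt0 bT; split.
  by move=> a x y /=; rewrite bT.1 bS.1.
exists (M * K) => x /=; apply: le_trans (SM _) _.
by rewrite -mulrA ler_pM2l.
Qed.

Lemma bounded_operator_lin (a : R) S T :
  bounded_operator S -> bounded_operator T -> bounded_operator (a *: S + T).
Proof.
move=> bS bT; have [M M0 SM] := bounded_operator_gt0 bS.
have [K K0 TK] := bounded_operator_gt0 bT; split.
  move=> b x y; rewrite !fctE bT.1 bS.1 !scalerDr !scalerA mulrC.
  by rewrite addrACA.
exists (`|a| * M + K) => x; rewrite !fctE; apply: le_trans (ler_normD _ _) _.
by rewrite normrZ mulrDl lerD // -mulrA ler_wpM2l.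
Qed.

Lemma bounded_operator_id : bounded_operator (@id X).
Proof. by split=> //; exists 1 => x; rewrite mul1r. Qed.

Lemma bounded_operator_zero : bounded_operator (fun=> 0 : X).
Proof.
split; first by move=> a x y; rewrite scaler0 addr0.
by exists 0 => x; rewrite normr0 mul0r.
Qed.

Lemma ler_opnorm T x : bounded_operator T -> `|T x| <= opnorm T * `|x|.
Proof.
move=> bT; have [M M0 TM] := bounded_operator_gt0 bT.
have ub : has_ubound [set `|T x| | x in [set x : X | `|x| <= 1]].
  exists M => _ [y /= y1 <-]; apply: le_trans (TM y) _.
  by rewrite ler_piMr // ltW.
have [->|x0] := eqVneq x 0.
  by rewrite (lin_op0 bT.1) !normr0 mulr0.
have nx : 0 < `|x| by rewrite normr_gt0.
have : `|T (`|x|^-1 *: x)| <= opnorm T.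
  apply: ub_le_sup => //; exists (`|x|^-1 *: x) => //=.
  by rewrite normrZ gtr0_norm ?invr_gt0 // mulVf // gt_eqF.
rewrite (lin_opZ _ _ bT.1) normrZ gtr0_norm ?invr_gt0 //.
by rewrite mulrC ler_pdivrMr.
Qed.

End BoundedOperators.

Section DiagonalOperators.
Context {R : realType} {N : nat} {X : completeNormedModType R}.
Context {iota : (nat -> R) -> X} (HX : is_schreier_space N iota).

Definition c0_bounded (u : nat -> X) := forall (b : nat -> R) m n t, 0 <= t ->
  (forall k, (m <= k < n)%N -> `|b k| <= t) ->
  `|\sum_(m <= k < n) b k *: u k| <= 2 * t.

(** The blocks of order [N - 1] have norm at least 1 because their supports are
    themselves sets of order [N]. *)
Lemma c0_sequence_exists : (0 < N)%N ->
  exists2 u : nat -> X, c0_bounded u & forall k, 1 <= `|u k|.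
Proof.
case: (N) HX => // M HM _; have [p [E [v bs]]] := @block_sequences R M.
have cv k : c00 (v k).
  case: (bs k) => _ Ep [_ _ vE _ _]; apply: (c00_supported _ vE).
  by apply: vE; apply/negP => /Ep; lia.
exists (fun k => iota (v k)) => [b m n t t0 bt|k]; last first.
  case: (bs k) => _ _ [EM v0 _ <- _]; apply: le_trans (ler_norm_iota HM (cv k) EM).
  by apply: ler_sum => i _; exact: ler_norm.
rewrite -(iota_sum HM) => [|i _]; last exact: cv.
apply: (norm_iota_le HM) => [|A AN]; first by apply: c00_sum => i _; exact: cv.
have v0 k i : 0 <= v k i by case: (bs k) => _ _ [].
apply: (@le_trans _ _ (\sum_(i <- A) \sum_(m <= k < n) t * v k i)).
  apply: ler_sum => i _; apply: le_trans (ler_norm_sum _ _ _) _.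
  rewrite big_nat [leRHS]big_nat; apply: ler_sum => k kmn.
  by rewrite normrM (ger0_norm (v0 _ _)) ler_wpM2r // bt.
rewrite exchange_big /= mulrC.
under eq_bigr do rewrite -mulr_sumr.
rewrite -mulr_sumr ler_wpM2l //; apply: le_trans (block_sequence_c0 n bs AN).
rewrite -(big_mkord xpredT (fun k => \sum_(i <- A) v k i)) /index_iota subn0.
apply: ler_sum_uniq_sub => [|i|i]; first exact: iota_uniq.
  by rewrite !mem_iota; lia.
exact: sumr_ge0.
Qed.

Context {u : nat -> X} (u_c0 : c0_bounded u).

Definition diag (D : set nat) (x : X) : X :=
  limn (series (fun k => ((k \in D)%:R * coord iota k x) *: u k)).

(** The partial sums are Cauchy because the coordinates of [x] tend to 0. *)
Lemma diag_cvg D x :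
  series (fun k => ((k \in D)%:R * coord iota k x) *: u k) @ \oo --> diag D x.
Proof.
apply/cauchy_cvgP/cauchy_seriesP => e e0.
have e4 : 0 < e / 4 by rewrite divr_gt0.
have [K KP] := coord_vanishes HX x e4.
exists ([set n | (K < n)%N], setT); first by split => //; exists K.+1.
case=> m n [/= Km _]; apply: (@le_lt_trans _ _ (2 * (e / 4))); last lra.
apply: u_c0; first exact: ltW.
move=> k /andP[mk _]; apply: le_trans (KP k (leq_trans Km mk)).
by rewrite normrM; case: (_ \in _); rewrite ?normr1 ?mul1r // normr0 mul0r.
Qed.

Lemma diag_linear D : linear (diag D).
Proof.
move=> a x y; apply: (norm_cvg_unique (@diag_cvg D _)).
rewrite (_ : series _ = fun n =>
  a *: series (fun k => ((k \in D)%:R * coord iota k x) *: u k) n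
  + series (fun k => ((k \in D)%:R * coord iota k y) *: u k) n).
  by apply: cvgD; [apply: cvgZl_tmp|]; exact: diag_cvg.
apply/funext => n; rewrite /series /= scaler_sumr -big_split /=.
apply: eq_bigr => k _; rewrite (coord_linear HX) scalerA -scalerDl; congr (_ *: _).
by ring.
Qed.

Lemma diag_approx D x (e : R) : 0 < e -> exists K, forall n, (K <= n)%N ->
  `|diag D x - \sum_(0 <= k < n) ((k \in D)%:R * coord iota k x) *: u k| < e.
Proof.
move=> e0; have /cvgrPdist_lt/(_ e e0) := @diag_cvg D x.
by case=> K _ KP; exists K => n Kn; apply: KP.
Qed.

Lemma diag_le (D : set nat) x (t : R) : 0 <= t -> (forall k, D k -> `|coord iota k x| <= t) ->
  `|diag D x| <= 2 * t.
Proof.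
move=> t0 xt; apply/ler_addgt0Pl => e e0; have [K KP] := diag_approx D x e0.
have := KP K (leqnn K); set s := \sum_(_ <= _ < _) _.
have : `|s| <= 2 * t.
  apply: u_c0 => // k _; rewrite normrM.
  have [/set_mem/xt kx|_] := boolP (k \in D); first by rewrite normr1 mul1r.
  by rewrite normr0 mul0r.
by have := ler_normD (diag D x - s) s; rewrite subrK; lra.
Qed.

Lemma diag_basis (D : set nat) k : (0 < k)%N -> D k -> diag D (basis iota k) = u k.
Proof.
move=> k0 Dk; apply/eqP; rewrite -subr_eq0 -normr_le0.
apply/ler_addgt0Pl => e e0; rewrite addr0.
have [K KP] := diag_approx D (basis iota k) e0.
apply/ltW; move: (KP _ (leq_maxl K k.+1)).
rewrite (bigD1_seq k) ?iota_uniq //=; last first.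
  by rewrite mem_index_iota /= leq_maxr.
rewrite mem_set // mul1r (coord_basis HX) // eqxx scale1r big1 ?addr0 // => j jk.
by rewrite (coord_basis HX) // (negPf jk) mulr0 scale0r.
Qed.

Lemma diag_bounded D : bounded_operator (diag D).
Proof.
split; first exact: diag_linear.
by exists 2 => x; apply: diag_le => // k _; exact: ler_coord HX _ _.
Qed.

End DiagonalOperators.
Arguments diag {R X} iota u D x.

(** * Functionals and infinite-dimensional subspaces *)

Section Functionals.
Context {R : realType} {X : normedModType R}.
Implicit Types (g : X -> R) (Y : set X).

Definition functional g := forall (a : R) x y, g (a *: x + y) = a * g x + g y.

Definition bounded_functional g := functional g /\ exists M : R, forall x, `|g x| <= M * `|x|.

Lemma functional0 g : functional g -> g 0 = 0.
Proof. by move=> lg; have := lg (-1) 0 0; rewrite scaleN1r oppr0 addr0 mulN1r addNr. Qed.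

Lemma functionalZ g (a : R) x : functional g -> g (a *: x) = a * g x.
Proof. by move=> lg; have := lg a x 0; rewrite !addr0 (functional0 lg) addr0. Qed.

Lemma functionalD g x y : functional g -> g (x + y) = g x + g y.
Proof. by move=> lg; have := lg 1 x y; rewrite scale1r mul1r. Qed.

Lemma functionalB g x y : functional g -> g (x - y) = g x - g y.
Proof. by move=> lg; rewrite functionalD // -scaleN1r functionalZ // mulN1r. Qed.

Lemma bounded_functional_gt0 g : bounded_functional g ->
  exists2 M : R, 0 < M & forall x, `|g x| <= M * `|x|.
Proof.
case=> _ [M gM]; exists (Num.max M 1); first by rewrite lt_max ltr01 orbT.
by move=> x; apply: le_trans (gM x) _; rewrite ler_wpM2r // le_max lexx.
Qed.

Lemma subspaceZ Y (a : R) x : linear_subspace Y -> Y x -> Y (a *: x).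
Proof. by move=> [Y0 YL] Yx; rewrite -[_ *: _]addr0; exact: YL. Qed.

Lemma subspaceD Y x y : linear_subspace Y -> Y x -> Y y -> Y (x + y).
Proof. by move=> [Y0 YL] Yx Yy; rewrite -[x]scale1r; exact: YL. Qed.

Lemma subspaceB Y x y : linear_subspace Y -> Y x -> Y y -> Y (x - y).
Proof. by move=> [Y0 YL] Yx Yy; rewrite addrC -scaleN1r; exact: YL. Qed.

Lemma subspace_sum Y (I : Type) (s : seq I) (P : pred I) (F : I -> X) :
  linear_subspace Y -> (forall i, P i -> Y (F i)) -> Y (\sum_(i <- s | P i) F i).
Proof.
by move=> Ysub YF; apply: big_ind => //; [exact: Ysub.1|move=> x y; exact: subspaceD].
Qed.

Lemma subspace_ker Y g : functional g -> linear_subspace Y ->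
  linear_subspace (Y `&` [set x | g x = 0]).
Proof.
move=> lg [Y0 YL]; split; first by split=> //; exact: functional0.
move=> a x y [Yx gx] [Yy gy]; split; first exact: YL.
by rewrite /= lg gx gy mulr0 addr0.
Qed.

(** A vector of [Y] outside the kernel of [g] spans [Y] together with the kernel. *)
Lemma infinite_dimensional_ker Y g : functional g -> linear_subspace Y ->
  ~ finite_dimensional Y -> ~ finite_dimensional (Y `&` [set x | g x = 0]).
Proof.
move=> lg Ysub Yinf [n [v vP]]; apply: Yinf.
have [[y [Yy gy]]|Yg] := pselect (exists y, Y y /\ g y != 0); last first.
  exists n, v => y Yy; apply: vP; split => //=; apply/eqP/negPn/negP => gy.
  by apply: Yg; exists y.
exists n.+1, (fun i => if unlift ord_max i is Some j then v j else y) => x Yx.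
have [|a _ ax] := vP (x - (g x / g y) *: y).
  split; first by apply: subspaceB => //; exact: subspaceZ.
  by rewrite /= functionalB // functionalZ // divfK // subrr.
exists (fun i => if unlift ord_max i is Some j then a j else g x / g y) => //.
rewrite big_ord_recr /= unlift_none -[RHS](subrK ((g x / g y) *: y)) -ax.
congr (_ + _); apply: eq_bigr => i _.
have -> : widen_ord (leqnSn n) i = lift ord_max i.
  by apply/val_inj; rewrite /= /bump leqNgt ltn_ord.
by rewrite liftK.
Qed.

Lemma infinite_dimensional_annihilated Y n (g : nat -> X -> R) :
  (forall j, functional (g j)) -> linear_subspace Y -> ~ finite_dimensional Y ->
  exists y, [/\ Y y, `|y| = 1 & forall j, (j < n)%N -> g j y = 0].
Proof.
move=> lg; elim: n Y => [|n IH] Y Ysub Yinf.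
  have [[y [Yy y0]]|Y0] := pselect (exists y, Y y /\ y != 0).
    exists (`|y|^-1 *: y); split => //; first exact: subspaceZ.
    by rewrite normrZ normfV normr_id mulVf // normr_eq0.
  case: Yinf; exists 0%N, (fun=> 0) => y Yy; exists (fun=> 0) => //.
  rewrite big_ord0; apply/esym/eqP/negPn/negP => y0.
  by apply: Y0; exists y.
have [|y [[Yy gy] y1 yg]] := IH _ (subspace_ker (lg n) Ysub).
  exact: infinite_dimensional_ker.
exists y; split => // j; rewrite ltnS leq_eqVlt => /orP[/eqP ->//|]; exact: yg.
Qed.

(** Continuity of the inverse at 0 gives a bound on a ball, and homogeneity
    spreads it. *)
Lemma isomorphism_bounded_below Y (T : X -> X) : linear_subspace Y ->
  linear T -> isomorphism_on Y T ->
  exists2 c : R, 0 < c & forall y, Y y -> c * `|y| <= `|T y|.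
Proof.
move=> Ysub lT [G Gc GT].
have G0 : G 0 = 0 by have := GT 0 Ysub.1; rewrite (lin_op0 lT).
have TY0 : (T @` Y) 0 by exists 0; [exact: Ysub.1|exact: lin_op0].
have := (subspace_continuousP _ _).1 Gc 0 TY0.
move=> /cvgrPdist_lt/(_ 1 ltr01); rewrite near_withinE => /nbhs_normP[d /= d0 dP].
have {}dP z : `|z| < d -> (T @` Y) z -> `|G z| < 1.
  move=> zd TYz; have := dP z; rewrite /ball_ /= sub0r normrN => /(_ zd TYz).
  by rewrite /from_subspace G0 sub0r normrN.
exists (d / 2); first by rewrite divr_gt0.
move=> y Yy; have [Ty0|Ty0] := eqVneq (T y) 0.
  by rewrite -(GT y Yy) Ty0 G0 !normr0 mulr0.
have nT : 0 < `|T y| by rewrite normr_gt0.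
pose a := (d / 2) / `|T y|; have a0 : 0 < a by rewrite !divr_gt0.
have Yay : Y (a *: y) by exact: subspaceZ.
have Tay : `|T (a *: y)| < d.
  by rewrite (lin_opZ _ _ lT) normrZ gtr0_norm // /a divfK ?gt_eqF //; lra.
have := dP _ Tay; rewrite GT // => /(_ _)/wrap[]; first by exists (a *: y).
rewrite normrZ gtr0_norm // /a mulrAC ltr_pdivrMr // mul1r; exact: ltW.
Qed.

End Functionals.

(** * Ideals of operators controlled by coordinates *)

Section CoordIdeal.
Context {R : realType} {N : nat} {X : completeNormedModType R}.
Context {iota : (nat -> R) -> X} (HX : is_schreier_space N iota).

(** Bounded functionals that recover the vectors of a finite-dimensional subspace
    are built from coordinates, which separate points. In the induction, [q] is the
    error of the decomposition found for those vectors of [W] that lie in the span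
    of the first [n] vectors; on the whole of [W] the error is a multiple of the
    single vector [q w0], and one coordinate of [q] that does not vanish at [w0]
    recovers the factor. *)
Lemma span_decomposition n (v : nat -> X) (W : set X) : linear_subspace W ->
  (forall x, W x -> exists a : nat -> R, x = \sum_(i < n) a i *: v i) ->
  exists m (g : nat -> X -> R) (w : nat -> X),
    (forall i, bounded_functional (g i)) /\
    forall x, W x -> x = \sum_(i < m) g i x *: w i.
Proof.
elim: n W => [|n IH] W Wsub Wv.
  exists 0%N, (fun=> fun=> 0), (fun=> 0); split => [i|x /Wv[a ->]]; last by rewrite !big_ord0.
  split; first by move=> a x y; rewrite mulr0 addr0.
  by exists 0 => x; rewrite normr0 mul0r.
pose W' := [set x | W x /\ exists a : nat -> R, x = \sum_(i < n) a i *: v i].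
have W'sub : linear_subspace W'.
  split.
    split; first exact: Wsub.1.
    by exists (fun=> 0); rewrite big1 // => i _; rewrite scale0r.
  move=> a x y [Wx [b xb]] [Wy [c yc]]; split; first exact: Wsub.2.
  exists (fun i => a * b i + c i); rewrite xb yc scaler_sumr -big_split /=.
  by apply: eq_bigr => i _; rewrite scalerA scalerDl.
have [m [g [w [bg gW']]]] := IH W' W'sub (fun x W'x => W'x.2).
have [WW'|] := pselect (forall x, W x -> W' x).
  by exists m, g, w; split=> // x /WW'; exact: gW'.
move/existsNP => [w0 /not_implyP[Ww0 nW'w0]].
have [a aw0] := Wv w0 Ww0.
have an : a n != 0.
  apply/eqP => an; apply: nW'w0; split=> //; exists a.
  by rewrite aw0 big_ord_recr /= an scale0r addr0.
pose q x := x - \sum_(i < m) g i x *: w i.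
have lq : linear q.
  move=> b x y; rewrite /q scalerBr scaler_sumr addrACA -opprD -big_split /=.
  congr (_ - _); apply: eq_bigr => i _.
  by rewrite (bg i).1 scalerDl scalerA.
have qW x : W x -> exists c, q x = c *: q w0.
  move=> Wx; have [b bx] := Wv x Wx; exists (b n / a n).
  have : W' (x - (b n / a n) *: w0).
    split; first by apply: subspaceB => //; exact: subspaceZ.
    exists (fun i => b i - b n / a n * a i).
    rewrite bx aw0 !big_ord_recr /= scalerDr scalerA divfK // opprD addrACA subrr addr0.
    rewrite scaler_sumr -sumrB; apply: eq_bigr => i _.
    by rewrite scalerA scalerBl.
  move/gW'/eqP; rewrite -subr_eq0 -/(q _) (lin_opB _ _ lq) (lin_opZ _ _ lq).
  by rewrite subr_eq0 => /eqP.
have [qw0|/eqP qw0] := pselect (q w0 = 0).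
  exists m, g, w; split=> // x /qW[c]; rewrite qw0 scaler0 /q => /eqP.
  by rewrite subr_eq0 => /eqP.
have [k kz] : exists k, coord iota k (q w0) != 0.
  apply: contrapT => nz; case/eqP: qw0; apply: (coord_total HX) => k.
  by apply/eqP/negPn/negP => kz; apply: nz; exists k.
(* On [W], this is the factor [c] with [q x = c *: q w0]. *)
pose h x := coord iota k (q x) / coord iota k (q w0).
exists m.+1, (fun i => if i == m then h else g i), (fun i => if i == m then q w0 else w i).
split.
  move=> i; case: eqP => // _; split.
    move=> b x y; rewrite /h lq (coord_linear HX).
    by rewrite mulrDl mulrA.
  have [K KP] : exists K : nat -> R, forall i x, `|g i x| <= K i * `|x|.
    have /choice[K KP] : forall i, exists K : R, forall x, `|g i x| <= K * `|x|.
      by move=> j; case: (bg j).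
    by exists K.
  exists ((1 + \sum_(i < m) K i * `|w i|) / `|coord iota k (q w0)|) => x.
  rewrite /h normrM normfV mulrAC ler_pM2r ?invr_gt0 ?normr_gt0 //.
  apply: le_trans (ler_coord HX _ _) _; apply: le_trans (ler_normB _ _) _.
  rewrite mulrDl mul1r lerD2l; apply: le_trans (ler_norm_sum _ _ _) _.
  rewrite mulr_suml; apply: ler_sum => j _; rewrite normrZ mulrAC.
  by rewrite ler_wpM2r.
move=> x Wx; rewrite big_ord_recr /= eqxx.
rewrite (eq_bigr (fun i : 'I_m => g i x *: w i)); last first.
  by move=> i _; rewrite ltn_eqF.
rewrite -[LHS](subrK (\sum_(i < m) g i x *: w i)) -/(q x) addrC; congr (_ + _).
have [c qx] := qW x Wx.
by rewrite /h qx (coordZ HX) mulfK.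
Qed.

Lemma finite_rank_bound (T : X -> X) : bounded_operator T -> finite_rank T ->
  exists m (g : nat -> X -> R) (C : R), [/\ forall i, bounded_functional (g i), 0 <= C &
    forall x (t : R), 0 <= t -> (forall i, (i < m)%N -> `|g i x| <= t) -> `|T x| <= C * t].
Proof.
move=> bT [n [v vP]].
have rsub : linear_subspace (range T).
  split; first by exists 0 => //; exact: lin_op0 bT.1.
  move=> a _ _ [x _ <-] [y _ <-]; exists (a *: x + y) => //; exact: bT.1.
have [|m [g [w [bg gw]]]] :=
    @span_decomposition n (fun i => if insub i is Some j then v j else 0) _ rsub.
  move=> x /vP[a _ <-]; exists (fun i => if insub i is Some j then a j else 0).
  by apply: eq_bigr => i _; rewrite valK.
exists m, (fun i => g i \o T), (\sum_(i < m) `|w i|); split.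
- move=> i; split; first by move=> a x y; rewrite /= bT.1 (bg i).1.
  have [M M0 TM] := bounded_operator_gt0 bT; have [K K0 gK] := bounded_functional_gt0 (bg i).
  exists (K * M) => x /=; apply: le_trans (gK _) _.
  by rewrite -mulrA ler_pM2l.
- by apply: sumr_ge0.
- move=> x t t0 gt; rewrite [T x]gw; last by exists x.
  apply: le_trans (ler_norm_sum _ _ _) _; rewrite mulr_suml.
  by apply: ler_sum => i _; rewrite normrZ mulrC ler_wpM2l // gt.
Qed.

(** The sets [[set 1]] stand for single functionals: [g] is the first coordinate of
    the operator [x |-> g x *: e_1]. *)
Definition coord_ideal (F : set (set nat)) : set (X -> X) := [set T |
  bounded_operator T /\ forall e : R, 0 < e ->
  exists m (D : nat -> set nat) (V : nat -> X -> X) (C : R),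
  [/\ forall i, F (D i) \/ D i = [set 1%N], forall i, bounded_operator (V i), 0 <= C &
    forall x (t : R), 0 <= t ->
      (forall i k, (i < m)%N -> D i k -> `|coord iota k (V i x)| <= t) ->
      `|T x| <= C * t + e * `|x|]].

Lemma coord_ideal_sub (F G : set (set nat)) : F `<=` G -> coord_ideal F `<=` coord_ideal G.
Proof.
move=> FG T [bT TP]; split=> // e e0; have [m [D [V [C [DF bV C0 VC]]]]] := TP e e0.
by exists m, D, V, C; split => // i; have [/FG|] := DF i; [left|right].
Qed.

Lemma coord_ideal_operator_ideal (F : set (set nat)) : (0 < N)%N ->
  operator_ideal (coord_ideal F).
Proof.
move=> N0; split.
- by move=> T [].
- split.
    split; first exact: bounded_operator_zero.
    move=> e e0; exists 0%N, (fun=> [set 1%N]), (fun=> id), 0; split=> //.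
    + by move=> _; right.
    + by move=> _; exact: bounded_operator_id.
    + by move=> x t t0 _; rewrite mul0r add0r /= normr0 mulr_ge0 // ltW.
  move=> a S T [bS SP] [bT TP]; split; first exact: bounded_operator_lin.
  move=> e e0; have a0 : 0 < 2 * (`|a| + 1) by rewrite mulr_gt0 // ltr_wpDl.
  have [|m [D [V [C [DF bV C0 VC]]]]] := SP (e / (2 * (`|a| + 1))).
    by rewrite divr_gt0.
  have [|m' [D' [V' [C' [DF' bV' C0' VC']]]]] := TP (e / 2).
    by rewrite divr_gt0.
  exists (m + m')%N, (fun i => if (i < m)%N then D i else D' (i - m)%N),
    (fun i => if (i < m)%N then V i else V' (i - m)%N), (`|a| * C + C'); split.
  + by move=> i; case: ifP.
  + by move=> i; case: ifP.
  + by rewrite addr_ge0 // mulr_ge0.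
  move=> x t t0 xt.
  have hS : `|S x| <= C * t + e / (2 * (`|a| + 1)) * `|x|.
    apply: VC => // i k im; have := xt i k; rewrite im; apply.
    by rewrite ltn_addr.
  have hT : `|T x| <= C' * t + e / 2 * `|x|.
    apply: VC' => // i k im; have := xt (m + i)%N k.
    have -> : (m + i < m)%N = false by lia.
    by rewrite addKn; apply; rewrite ltn_add2l.
  have ha : `|a| * (e / (2 * (`|a| + 1))) <= e / 2.
    have a1 : 0 < `|a| + 1 by rewrite ltr_wpDl.
    have -> : `|a| * (e / (2 * (`|a| + 1))) = e / 2 * (`|a| / (`|a| + 1)).
      by field; rewrite gt_eqF.
    apply: ler_piMr; first by rewrite divr_ge0 // ltW.
    by rewrite ler_pdivrMr // mul1r lerDl.
  rewrite !fctE; apply: le_trans (ler_normD _ _) _; rewrite normrZ.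
  have h1 : `|a| * `|S x| <= `|a| * (C * t + e / (2 * (`|a| + 1)) * `|x|) by rewrite ler_wpM2l.
  have h2 : `|a| * (e / (2 * (`|a| + 1))) * `|x| <= e / 2 * `|x| by rewrite ler_wpM2r.
  have -> : (`|a| * C + C') * t + e * `|x| =
    (`|a| * (C * t)) + e / 2 * `|x| + (C' * t + e / 2 * `|x|) by field.
  apply: lerD => //; apply: le_trans h1 _.
  by rewrite mulrDr lerD2l mulrA.
- move=> S T U bS [bT TP] bU.
  split; first by apply: bounded_operator_comp => //; exact: bounded_operator_comp.
  move=> e e0; have [M M0 SM] := bounded_operator_gt0 bS.
  have [K K0 UK] := bounded_operator_gt0 bU.
  have [|m [D [V [C [DF bV C0 VC]]]]] := TP (e / (M * K)).
    by rewrite divr_gt0 // mulr_gt0.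
  exists m, D, (fun i => V i \o U), (M * C); split => //.
  + by move=> i; exact: bounded_operator_comp.
  + by rewrite mulr_ge0 // ltW.
  move=> x t t0 xt; apply: le_trans (SM _) _.
  apply: (@le_trans _ _ (M * (C * t + e / (M * K) * `|U x|))).
    by rewrite ler_pM2l //; apply: VC.
  rewrite mulrDr mulrA lerD2l.
  apply: (@le_trans _ _ (M * (e / (M * K) * (K * `|x|)))).
    by rewrite ler_pM2l // ler_wpM2l // ltW // divr_gt0 // mulr_gt0.
  have -> // : M * (e / (M * K) * (K * `|x|)) = e * `|x|.
  by field; rewrite !gt_eqF.
- move=> T bT rT; split=> // e e0.
  have [m [g [C [bg C0 gC]]]] := finite_rank_bound bT rT.
  exists m, (fun=> [set 1%N]), (fun i x => g i x *: basis iota 1), C; split => //.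
  + by move=> _; right.
  + move=> i; split; first by move=> a x y; rewrite (bg i).1 scalerDl scalerA.
    have [K K0 gK] := bounded_functional_gt0 (bg i).
    exists (K * `|basis iota 1|) => x; rewrite normrZ mulrAC.
    by rewrite ler_wpM2r.
  move=> x t t0 xt; apply: ler_wpDr; first by rewrite mulr_ge0 // ltW.
  apply: gC => // i im; have := xt i 1%N im (erefl _).
  by rewrite (coordZ HX) (coord_basis HX) // eqxx mulr1.
Qed.

Lemma coord_ideal_closed (F : set (set nat)) : norm_closed (coord_ideal F).
Proof.
move=> T bT TP; split=> // e e0; have e2 : 0 < e / 2 by rewrite divr_gt0.
have [S [bS SP] TS] := TP _ e2.
have [m [D [V [C [DF bV C0 VC]]]]] := SP _ e2.
exists m, D, V, C; split => // x t t0 xt.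
have bTS : bounded_operator (T \- S).
  have -> : T \- S = (-1) *: S + T.
    by apply/funext => y; rewrite !fctE scaleN1r addrC.
  exact: bounded_operator_lin.
have h1 := ler_opnorm x bTS; have h2 := VC x t t0 xt.
have h3 : opnorm (T \- S) * `|x| <= e / 2 * `|x| by rewrite ler_wpM2r // ltW.
have := ler_normD (T x - S x) (S x); rewrite subrK.
have -> : e * `|x| = e / 2 * `|x| + e / 2 * `|x| by field.
move: h1; rewrite /=; lra.
Qed.

Lemma diag_coord_ideal u (u_c0 : @c0_bounded R X u) (F : set (set nat)) D :
  F D -> coord_ideal F (diag iota u D).
Proof.
move=> FD; split; first exact: (diag_bounded HX u_c0).
move=> e e0; exists 1%N, (fun=> D), (fun=> id), 2; split=> //.
- by move=> _; left.
- by move=> _; exact: bounded_operator_id.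
move=> x t t0 xt; apply: ler_wpDr; first by rewrite mulr_ge0 // ltW.
by apply: (diag_le HX u_c0) => // k Dk; exact: (xt 0%N).
Qed.

End CoordIdeal.
Arguments coord_ideal {R X} iota F.

(** * Strict singularity *)

Section StrictSingularity.
Context {R : realType} {N : nat} {X : completeNormedModType R}.
Context {iota : (nat -> R) -> X} (HX : is_schreier_space N iota) (N0 : (0 < N)%N).

Lemma ler_sum_coord_few (s : seq nat) x : uniq s ->
  (forall k, k \in s -> (size s <= k)%N) -> \sum_(k <- s) `|coord iota k x| <= `|x|.
Proof.
move=> us sk; have sE : perm_eq (seq_fset tt s) s.
  by apply: perm_trans (seq_fset_perm tt s) _; rewrite undup_id.
rewrite -(perm_big _ sE); apply: (ler_sum_coord HX); apply: schreier_few => // k.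
by rewrite seq_fsetE => /sk; apply: leq_trans; rewrite (perm_size sE).
Qed.

Lemma common_bound m (V : nat -> X -> X) : (forall i, bounded_operator (V i)) ->
  exists2 M : R, 0 < M & forall i x, (i < m)%N -> `|V i x| <= M * `|x|.
Proof.
move=> bV; have /choice[K KP] : forall i, exists K : R,
    0 < K /\ forall x, `|V i x| <= K * `|x|.
  by move=> i; have [K K0 VK] := bounded_operator_gt0 (bV i); exists K.
exists (1 + \sum_(i < m) K i).
  by rewrite ltr_wpDr // sumr_ge0 // => i _; apply: ltW; case: (KP i).
move=> i x im; apply: le_trans (proj2 (KP i) x) _; rewrite ler_wpM2r //.
rewrite (bigD1 (Ordinal im)) //= addrCA lerDl addr_ge0 // sumr_ge0 // => j _.
by apply: ltW; case: (KP j).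
Qed.

Lemma coord_vanishes_uniformly m (V : nat -> X -> X) x (e : R) : 0 < e ->
  exists K, forall i k, (i < m)%N -> (K < k)%N -> `|coord iota k (V i x)| <= e.
Proof.
move=> e0; have /choice[K KP] : forall i, exists K, forall k, (K < k)%N ->
    `|coord iota k (V i x)| <= e.
  by move=> i; exact: (coord_vanishes HX).
exists (\max_(i < m) K i) => i k im Kk; apply: KP.
exact: leq_ltn_trans (leq_bigmax (Ordinal im)) Kk.
Qed.

(** That the first coordinates of all [V i y] vanish is a finite number of linear
    conditions, so [Y] contains such a unit vector; the coordinates far out are
    small. *)
Lemma hump_exists m (V : nat -> X -> X) (Y : set X) (e : R) K :
  (forall i, bounded_operator (V i)) -> linear_subspace Y -> ~ finite_dimensional Y ->
  0 < e -> exists yK : X * nat, [/\ Y yK.1, `|yK.1| = 1, (K < yK.2)%N &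
    forall i k, (i < m)%N -> ((k <= K)%N -> coord iota k (V i yK.1) = 0) /\
      ((yK.2 < k)%N -> `|coord iota k (V i yK.1)| <= e)].
Proof.
move=> bV Ysub Yinf e0.
have [|y [Yy y1 y0]] := @infinite_dimensional_annihilated R X Y (m * K.+1)
  (fun j x => coord iota (j %% K.+1) (V (j %/ K.+1)%N x)) _ Ysub Yinf.
  by move=> j a x z; rewrite (bV _).1 (coord_linear HX).
have [K' KP] := coord_vanishes_uniformly m V y e0.
exists (y, maxn K' K.+1); split => //=; first by rewrite leq_maxr.
move=> i k im; split => [kK|Kk]; last first.
  by apply: KP => //; apply: leq_ltn_trans Kk; rewrite leq_maxl.
have := y0 (i * K.+1 + k)%N; rewrite modnMDl modn_small // divnMDl // divn_small // addn0.
by apply; have := leq_mul im (leqnn K.+1); rewrite mulSn; lia.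
Qed.

(** Setting of the gliding hump: up to [e], the vectors [V i (y j)] live in the
    window [(kappa j, kappa j.+1]], and [V (idx j)] gives [y j] a coordinate larger
    than [d] at [k j]. *)
Section Humps.
Variables (m n : nat) (V : nat -> X -> X) (Y : set X) (M C e d : R).
Variables (y : nat -> X) (kappa : nat -> nat) (k idx : nat -> nat).
Hypothesis bV : forall i, bounded_operator (V i).
Hypothesis Ysub : linear_subspace Y.
Hypothesis VM : forall i x, (i < m)%N -> `|V i x| <= M * `|x|.
Hypothesis YC : forall x (t : R), Y x -> 0 <= t ->
  (forall i k, (i < m)%N -> `|coord iota k (V i x)| <= t) -> `|x| <= C * t.
Hypothesis Yy : forall j, Y (y j).
Hypothesis y1 : forall j, `|y j| = 1.
Hypothesis M0 : 0 < M.
Hypothesis e0 : 0 < e.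
Hypothesis kappaS : forall j, (kappa j < kappa j.+1)%N.
Hypothesis kappa0 : (n <= kappa 0)%N.
Hypothesis hump : forall j i k, (i < m)%N -> ~~ (kappa j < k <= kappa j.+1)%N ->
  `|coord iota k (V i (y j))| <= e.
Hypothesis peak : forall j, [/\ (idx j < m)%N, (kappa j < k j <= kappa j.+1)%N &
  d < `|coord iota (k j) (V (idx j) (y j))|].
Hypothesis ne : e *+ n <= 1.
Hypothesis ned : e *+ n <= d / 2.

Let s i := \sum_(j < n | idx j == i) y j.

(** Each coordinate of each [V i' (s i)] receives a full contribution from at most
    one hump. *)
Lemma hump_sum_le i : `|s i| <= C * (M + 1).
Proof.
apply: YC; first by apply: subspace_sum.
  by rewrite addr_ge0 // ltW.
move=> i' l i'm; rewrite /s (lin_op_sum _ _ _ (bV i').1) (coord_sum HX).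
apply: le_trans (ler_norm_sum _ _ _) _; rewrite big_mkcond /=.
apply: (@le_trans _ _ (\sum_(j < n) (M * (kappa j < l <= kappa j.+1)%N%:R + e))).
  apply: ler_sum => j _.
  have h0 : 0 <= M * (kappa j < l <= kappa j.+1)%N%:R + e.
    by rewrite addr_ge0 ?mulr_ge0 // ltW.
  case: ifP => // _; have [jl|jl] := boolP (kappa j < l <= kappa j.+1)%N.
    rewrite mulr1; apply: (@le_trans _ _ M); last by rewrite lerDl ltW.
    apply: le_trans (ler_coord HX _ _) _; apply: le_trans (VM _ i'm) _.
    by rewrite y1 mulr1.
  by rewrite mulr0 add0r hump.
rewrite big_split /= -mulr_sumr; apply: lerD.
  rewrite ler_piMr ?(ltW M0) //.
  apply: (@sum_at_most_one _ n (fun j => kappa j < l <= kappa j.+1)%N) => a b.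
  exact: window_uniq kappaS.
by rewrite sumr_const card_ord.
Qed.

(** The peaks [k j] of the summands of [s i] are different and lie beyond [n], so they
    form a Schreier set, and the other summands disturb each of them by at most
    [e n <= d / 2]. *)
Lemma hump_sum_ge i : (i < m)%N -> d / 2 *+ #|[pred j : 'I_n | idx j == i]| <= `|V i (s i)|.
Proof.
move=> im; pose J := [seq j <- index_iota 0 n | idx j == i].
have k_inj : {in J &, injective k}.
  move=> a b _ _ kab; have [_ ka _] := peak a; have [_ kb _] := peak b.
  by apply: (window_uniq kappaS ka); rewrite kab.
have uJ : uniq J by rewrite filter_uniq // iota_uniq.
have sJ : (size J <= n)%N.
  by rewrite size_filter (leq_trans (count_size _ _)) ?size_iota ?subn0.
have := @ler_sum_coord_few (map k J) (V i (s i)).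
rewrite map_inj_in_uniq // size_map => /(_ uJ); rewrite big_map => h.
have {h} : \sum_(j <- J) `|coord iota (k j) (V i (s i))| <= `|V i (s i)|.
  apply: h => _ /mapP[j _ ->]; have [_ /andP[kj _] _] := peak j.
  apply: leq_trans sJ (leq_trans kappa0 _).
  exact: (leq_trans (increasing_leq kappaS (leq0n j)) (ltnW kj)).
apply: le_trans; rewrite big_filter.
rewrite big_mkord -sumr_const.
apply: ler_sum => j /eqP ij; have [_ kj] := peak j; rewrite ij.
rewrite /s (lin_op_sum _ _ _ (bV i).1) (coord_sum HX) (bigD1 j) /= ?ij //.
set a := coord _ _ _ => da; set b := \sum_(_ < _ | _) _.
have hb : `|b| <= e *+ n.
  apply: le_trans (ler_norm_sum _ _ _) _.
  rewrite -[n in leRHS]card_ord -sumr_const big_mkcond /=; apply: ler_sum => l _.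
  case: ifP => [/andP[_ lj]|_]; last exact: ltW.
  apply: hump => //; apply: contra lj => lk; apply/eqP/val_inj.
  exact: window_uniq kappaS lk kj.
have := ler_normB (a + b) b; have := le_trans hb ned; rewrite addrK; lra.
Qed.

(** The [n] humps are shared out among the [m] values of [idx]. *)
Lemma hump_count_le : d / 2 *+ n <= (M * (C * (M + 1))) *+ m.
Proof.
have -> : n = (\sum_(i < m) #|[pred j : 'I_n | idx j == i]|)%N.
  rewrite -[LHS]card_ord -sum1_card.
  pose idx' (j : 'I_n) : 'I_m := Ordinal (let: And3 h _ _ := peak j in h).
  rewrite (partition_big idx' xpredT) //=.
  by apply: eq_bigr => i _; rewrite -sum1_card; apply: eq_bigl => j; rewrite inE.
rewrite -sumrMnr -[m in leRHS]card_ord -sumr_const; apply: ler_sum => i _.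
apply: le_trans (hump_sum_ge (ltn_ord i)) _.
by apply: le_trans (VM _ (ltn_ord i)) _; rewrite ler_pM2l // hump_sum_le.
Qed.

End Humps.

Lemma no_coord_domination m (V : nat -> X -> X) (Y : set X) (C : R) :
  (forall i, bounded_operator (V i)) -> linear_subspace Y -> ~ finite_dimensional Y ->
  ~ (forall x (t : R), Y x -> 0 <= t ->
      (forall i k, (i < m)%N -> `|coord iota k (V i x)| <= t) -> `|x| <= C * t).
Proof.
move=> bV Ysub Yinf YC'.
have [M M0 VM] := common_bound m bV.
pose C1 := Num.max C 1.
have C11 : 1 <= C1 by rewrite le_max lexx orbT.
have C10 : 0 < C1 by exact: lt_le_trans ltr01 C11.
have YC x (t : R) : Y x -> 0 <= t ->
    (forall i k, (i < m)%N -> `|coord iota k (V i x)| <= t) -> `|x| <= C1 * t.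
  move=> Yx t0 xt; apply: le_trans (YC' x t Yx t0 xt) _.
  by rewrite ler_wpM2r // le_max lexx.
(* With this [d], a unit vector of [Y] must have a coordinate above [d]. *)
pose d := C1^-1 / 2; have d0 : 0 < d by rewrite divr_gt0 // invr_gt0.
have d1 : d <= 1 / 2 by rewrite ler_pM2r ?invr_gt0 // invf_le1.
(* More humps than [hump_count_le] allows. *)
pose n := (Num.trunc ((M * (C1 * (M + 1))) *+ m / (d / 2))).+1.
have nP : (M * (C1 * (M + 1))) *+ m < d / 2 *+ n.
  rewrite -[ltRHS]mulr_natr [ltRHS]mulrC -ltr_pdivrMr; first exact: truncnS_gt.
  by rewrite divr_gt0.
have n0 : 0 < n%:R :> R by rewrite ltr0n.
pose e := d / 2 / n%:R; have e0 : 0 < e by rewrite divr_gt0 // divr_gt0.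
have ned : e *+ n = d / 2 by rewrite -[LHS]mulr_natr /e divfK // gt_eqF.
have /choice[g gP] : forall K, exists yK : X * nat, [/\ Y yK.1, `|yK.1| = 1, (K < yK.2)%N &
    forall i k, (i < m)%N -> ((k <= K)%N -> coord iota k (V i yK.1) = 0) /\
      ((yK.2 < k)%N -> `|coord iota k (V i yK.1)| <= e)].
  by move=> K; exact: hump_exists.
pose kappa j := iter j (fun K => (g K).2) n.
pose y j := (g (kappa j)).1.
have hump j i k : (i < m)%N -> ~~ (kappa j < k <= kappa j.+1)%N ->
    `|coord iota k (V i (y j))| <= e.
  move=> im; have [_ _ _ /(_ i k im)[lo hi]] := gP (kappa j).
  rewrite negb_and -leqNgt -ltnNge => /orP[/lo|/hi//]; rewrite /y => ->.
  by rewrite normr0 ltW.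
have /choice[ki kiP] : forall j, exists ki : nat * nat, [/\ (ki.2 < m)%N,
    (kappa j < ki.1 <= kappa j.+1)%N & d < `|coord iota ki.1 (V ki.2 (y j))|].
  move=> j; apply: contrapT => nk; have [Yy y1 _ _] := gP (kappa j).
  have : `|y j| <= C1 * d.
    apply: YC => //; first exact: ltW.
    move=> i k im; rewrite leNgt; apply/negP => dk; apply: nk; exists (k, i); split => //=.
    apply/negPn/negP => /(hump _ _ _ im); apply/negP; rewrite -ltNge.
    apply: le_lt_trans dk; rewrite /e ler_pdivrMr // ler_pM2l //.
    by apply: (@le_trans _ _ 1); [rewrite invf_le1 ?ler1n|rewrite ler1n].
  by rewrite /y y1 /d mulrA divff ?gt_eqF // => h; lra.
have kS j : (kappa j < kappa j.+1)%N by have [] := gP (kappa j).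
have Yy j : Y (y j) by have [] := gP (kappa j).
have y1 j : `|y j| = 1 by have [] := gP (kappa j).
have ne1 : e *+ n <= 1 by rewrite ned; lra.
have ned' : e *+ n <= d / 2 by rewrite ned.
have := @hump_count_le m n V Y M C1 e d y kappa (fun j => (ki j).1) (fun j => (ki j).2)
  bV Ysub VM YC Yy y1 M0 e0 kS (leqnn n) hump kiP ne1 ned'.
by rewrite leNgt; move/negP; apply.
Qed.

Lemma coord_ideal_strictly_singular (F : set (set nat)) :
  coord_ideal iota F `<=` strictly_singular (X:=X).
Proof.
move=> T [bT TP]; split=> // Y Ysub Yinf isoT.
have [c c0 cT] := isomorphism_bounded_below Ysub bT.1 isoT.
have c2 : 0 < c / 2 by rewrite divr_gt0.
have [m [D [V [C [_ bV C0 VC]]]]] := TP _ c2.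
apply: (@no_coord_domination m V Y (C / (c / 2)) bV Ysub Yinf) => x t Yx t0 xt.
have h := VC x t t0 (fun i k im _ => xt i k im).
have := cT x Yx; rewrite mulrAC ler_pdivlMr //; lra.
Qed.

Lemma coord_ideal_small (F : set (set nat)) : small_closed_ideal (coord_ideal iota F).
Proof.
split; [exact: (coord_ideal_operator_ideal HX)|exact: coord_ideal_closed|].
exact: coord_ideal_strictly_singular.
Qed.

End StrictSingularity.

(** * Separating the ideals *)

Lemma sum_fibers (V : nmodType) (s K : seq nat) (k : nat -> nat) (F : nat -> nat -> V) :
  uniq K -> (forall n, n \in s -> k n \in K) ->
  \sum_(j <- K) \sum_(n <- s | k n == j) F j n = \sum_(n <- s) F (k n) n.
Proof.
move=> uK kK; rewrite (exchange_big_dep xpredT) //= big_seq [RHS]big_seq.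
apply: eq_bigr => n ns; rewrite big_mkcond (bigD1_seq (k n)) ?kK //= eqxx.
by rewrite big1 ?addr0 // => j; rewrite eq_sym => /negPf ->.
Qed.

(** For random signs the mean of the right-hand side is the trace. The signs are
    chosen one at a time: the sign of [k0] makes its cross term [s * z] with the
    previous ones non-negative. *)
Lemma exists_signs_ge_trace (R : realType) (K : seq nat) (w : nat -> nat -> R) : uniq K ->
  exists2 th : nat -> R, (forall k, `|th k| = 1) &
    \sum_(k <- K) w k k <= \sum_(k <- K) th k * \sum_(j <- K) th j * w j k.
Proof.
elim: K => [|k0 K IH] /=.
  by move=> _; exists (fun=> 1) => [k|]; rewrite ?normr1 // !big_nil.
case/andP=> k0K /IH[th th1 thP]; set Q := (X in _ <= X) in thP.
pose z := \sum_(j <- K) th j * w j k0 + \sum_(j <- K) th j * w k0 j.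
pose s : R := if 0 <= z then 1 else -1.
have sz : 0 <= s * z.
  by rewrite /s; case: (lerP 0 z) => z0; rewrite ?mul1r // mulN1r oppr_ge0 ltW.
have ss : s * s = 1 by rewrite /s; case: ifP => _; rewrite ?mulrNN mulr1.
pose th' k := if k == k0 then s else th k.
have th'K (G : nat -> R -> R) : \sum_(j <- K) G j (th' j) = \sum_(j <- K) G j (th j).
  rewrite big_seq [RHS]big_seq; apply: eq_bigr => j jK; rewrite /th'.
  by case: eqP jK k0K => // -> ->.
exists th' => [k|].
  by rewrite /th' /s; do 2?case: ifP => //; rewrite ?normrN ?normr1.
rewrite !big_cons {1 2}/th' eqxx (th'K (fun j t => t * w j k0)).
rewrite (th'K (fun k t => t * \sum_(j <- k0 :: K) th' j * w j k)).
have -> : \sum_(k <- K) th k * \sum_(j <- k0 :: K) th' j * w j k =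
    s * (\sum_(j <- K) th j * w k0 j) + Q.
  rewrite mulr_sumr -big_split /=; apply: eq_bigr => k _.
  rewrite big_cons {1}/th' eqxx (th'K (fun j t => t * w j k)).
  by rewrite mulrDr mulrCA.
have -> : s * (s * w k0 k0 + \sum_(j <- K) th j * w j k0) +
    (s * (\sum_(j <- K) th j * w k0 j) + Q) = (s * s) * w k0 k0 + s * z + Q.
  by rewrite /z; ring.
rewrite ss; lra.
Qed.

Section Separation.
Context {R : realType} {N : nat} {X : completeNormedModType R}.
Context {iota : (nat -> R) -> X} (HX : is_schreier_space N iota) (N0 : (0 < N)%N).

Lemma ler_norm_basis n : (0 < n)%N -> `|basis iota n| <= 1.
Proof.
move=> n0; apply: (norm_iota_le HX) => [|A _]; first exact: c00_unit_seq.
apply: le_trans (@sum_supported _ _ _ [fset n]%fset _ _ _) _ => //.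
  by move=> i; rewrite inE /unit_seq => /negPf ->; rewrite normr0.
by rewrite big_seq_fset1 /unit_seq eqxx normr1.
Qed.

(** Suppose that the operator [V] sends each [e_n] to a vector with a large
    coordinate at [k n], and that these places lie in one Schreier set [K]. For a
    good choice of signs, depending on [n] through [k n] and through the sign of
    that coordinate, the image of [sum_n +-a_n e_n] has at the places of [K] a total
    of at least [d sum_n a_n]; other contributions to the coordinate [k n] are
    harmless by [exists_signs_ge_trace]. *)
Lemma aligned_mass_le (V : X -> X) (M d h : R) (s : seq nat) (a : nat -> R)
    (k : nat -> nat) (K : {fset nat}) :
  bounded_operator V -> (forall x, `|V x| <= M * `|x|) -> 0 <= M ->
  schreier N K -> (forall n, 0 <= a n) ->
  (forall n, n \in s -> k n \in K /\ d <= `|coord iota (k n) (V (basis iota n))|) ->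
  (forall sg : nat -> R, (forall n, `|sg n| <= 1) ->
     `|\sum_(n <- s) (sg n * a n) *: basis iota n| <= h) ->
  d * \sum_(n <- s) a n <= M * h.
Proof.
move=> bV VM M0 KN a0 kP sh.
pose c n j := coord iota j (V (basis iota n)).
pose w j l := \sum_(n <- s | k n == j) Num.sg (c n (k n)) * a n * c n l.
have [th th1 thP] := exists_signs_ge_trace w (fset_uniq K).
pose x := \sum_(n <- s) (th (k n) * Num.sg (c n (k n)) * a n) *: basis iota n.
have xh : `|x| <= h.
  apply: (sh (fun n => th (k n) * Num.sg (c n (k n)))) => n.
  by rewrite normrM th1 mul1r normr_sg lern1; case: (_ != _).
have kK n : n \in s -> k n \in enum_fset K by move=> /kP[].
have cx l : coord iota l (V x) = \sum_(j <- K) th j * w j l.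
  rewrite (lin_op_sum _ _ _ bV.1) (coord_sum HX).
  under [RHS]eq_bigr do rewrite mulr_sumr.
  pose F j n := th j * (Num.sg (c n (k n)) * a n * c n l).
  rewrite (sum_fibers F _ kK) ?fset_uniq //.
  by apply: eq_bigr => n _; rewrite /F (lin_opZ _ _ bV.1) (coordZ HX) !mulrA.
have tr : \sum_(j <- K) w j j = \sum_(n <- s) a n * `|c n (k n)|.
  rewrite /w (sum_fibers (fun j n => Num.sg (c n (k n)) * a n * c n j) _ kK) ?fset_uniq //.
  by apply: eq_bigr => n _; rewrite mulrAC -normrEsg mulrC.
apply: (@le_trans _ _ (\sum_(j <- K) w j j)).
  rewrite tr mulr_sumr big_seq [leRHS]big_seq; apply: ler_sum => n ns.
  by rewrite mulrC ler_wpM2l //; case: (kP n ns).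
apply: le_trans thP _; apply: (@le_trans _ _ (\sum_(j <- K) `|coord iota j (V x)|)).
  by apply: ler_sum => j _; rewrite -cx -[leRHS]mul1r -(th1 j) -normrM ler_norm.
apply: le_trans (ler_sum_coord HX _ KN) _; apply: le_trans (VM x) _.
by rewrite ler_wpM2l.
Qed.

Context {p : nat -> nat} {E : nat -> {fset nat}} {v : nat -> nat -> R}.
Hypothesis bs : block_sequence N p E v.

Definition windows (Q : set nat) : set nat :=
  [set k | exists2 i, Q i & (p i < k <= p i.+1)%N].

Lemma ler_norm_block i (s : seq nat) (sg : nat -> R) : uniq s -> {subset s <= E i} ->
  (forall n, `|sg n| <= 1) ->
  `|\sum_(n <- s) (sg n * v i n) *: basis iota n| <= 2 ^- i.+1 / (p i).+1%:R.
Proof.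
move=> us sE sg1; have [_ EP [_ v0 _ _ vN]] := bs i.
have c0s n : n \in s -> c00 (unit_seq n : nat -> R).
  by move=> /sE/EP/andP[np _]; apply: c00_unit_seq; lia.
rewrite -(iota_sum HX _ c0s); apply: (norm_iota_le HX); first exact: c00_sum.
move=> A AN; apply: le_trans (vN A AN); apply: ler_sum => l _.
have [ls|ls] := boolP (l \in s); last first.
  rewrite big_seq big1 ?normr0 // => n ns; rewrite /unit_seq.
  by case: eqP ns ls => [-> ->|_ _ _]; rewrite ?mulr0.
rewrite (bigD1_seq l) //= big1 ?addr0; last first.
  by move=> n nl; rewrite /unit_seq eq_sym (negPf nl) mulr0.
by rewrite /unit_seq eqxx mulr1 normrM (ger0_norm (v0 _)) ler_piMl.
Qed.

Lemma card_block i : (#|` E i| <= p i.+1)%N.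
Proof.
rewrite -[p i.+1](size_iota 1); apply: uniq_leq_size; first exact: fset_uniq.
by move=> n; have [_ EP _] := bs i => /EP; rewrite mem_iota; lia.
Qed.

(** The indices of the block are classified by [j n] and by the place [k n] when it
    is at most [p i], the class 0 collecting the places beyond [p i.+1]. In each
    of the [m.+1 * (p i).+1] classes the places form a Schreier set: a singleton,
    or at most [p i.+1] numbers above [p i.+1]. So [aligned_mass_le] applies. *)
Lemma block_mass_lt m (V : nat -> X -> X) (M d : R) i (j k : nat -> nat) :
  (forall l, bounded_operator (V l)) ->
  (forall l x, (l < m.+1)%N -> `|V l x| <= M * `|x|) -> 0 <= M ->
  (forall n, n \in E i -> [/\ (j n < m.+1)%N, (0 < k n)%N,
     ~~ (p i < k n <= p i.+1)%N & d <= `|coord iota (k n) (V (j n) (basis iota n))|]) ->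
  d <= m.+1%:R * M * 2 ^- i.+1.
Proof.
move=> bV VM M0 jkP; have [_ EP [_ v0 _ v1 _]] := bs i.
pose code n : 'I_m.+1 * 'I_(p i).+1 :=
  (inord (j n), inord (if (k n <= p i)%N then k n else 0%N)).
pose h : R := 2 ^- i.+1 / (p i).+1%:R.
have class c : d * \sum_(n <- E i | code n == c) v i n <= M * h.
  case: c => [c1 c2]; pose s := [seq n <- E i | code n == (c1, c2)].
  rewrite -big_filter -/s.
  have us : uniq s by rewrite filter_uniq // fset_uniq.
  have sE : {subset s <= E i} by move=> n; rewrite mem_filter => /andP[].
  have sP n : n \in s -> [/\ j n = c1, (0 < k n)%N,
      (k n = c2 :> nat /\ (0 < c2)%N) \/ (nat_of_ord c2 = 0%N /\ (p i.+1 < k n)%N)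
      & d <= `|coord iota (k n) (V (j n) (basis iota n))|].
    rewrite mem_filter => /andP[/eqP[<- <-] /jkP[jm k0 kw dk]]; split => //.
      by rewrite inordK.
    rewrite inordK; last by case: ifP => //; rewrite ltnS.
    case: ifP => kp; [left|right] => //; split => //.
    by move: kw; rewrite ltnNge kp /= -ltnNge.
  pose K : {fset nat} :=
    if (c2 : nat) == 0%N then seq_fset tt (map k s) else [fset nat_of_ord c2]%fset.
  apply: (@aligned_mass_le (V c1) M d h s (v i) k K) => //.
  - by move=> x; exact: VM.
  - rewrite /K; case: eqP => [c20|/eqP c20]; last first.
      by apply: schreier_fset1; rewrite lt0n.
    apply: schreier_few => // l; rewrite seq_fsetE => /mapP[n ns ->].
    have [_ _ [[_ c2_gt0]|[_ pk]] _] := sP n ns; first by rewrite c20 in c2_gt0.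
    apply: leq_trans (ltnW pk); apply: leq_trans (card_block i).
    rewrite size_seq_fset; apply: leq_trans (size_undup _) _; rewrite size_map.
    by apply: uniq_leq_size.
  - move=> n ns; have [jc1 _ kc2 dk] := sP n ns; split; last by rewrite -jc1.
    rewrite /K; case: eqP => [c20|/eqP c20].
      by rewrite seq_fsetE; exact: map_f.
    by case: kc2 => [[-> _]|[c2' _]]; [rewrite inE|rewrite c2' in c20].
  - by move=> sg; exact: ler_norm_block.
rewrite -[leLHS]mulr1 -[X in _ * X <= _]v1 (partition_big code xpredT) //= mulr_sumr.
apply: le_trans (ler_sum _ (fun c _ => class c)) _.
rewrite sumr_const card_prod !card_ord -[leLHS]mulr_natr natrM /h.
have p0 : (p i).+1%:R != 0 :> R by rewrite pnatr_eq0.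
move: (p i).+1%:R (m.+1%:R : R) (2 ^- i.+1 : R) p0 => P m1 t p0.
by rewrite le_eqVlt; apply/orP; left; apply/eqP; field.
Qed.

Context {u : nat -> X} (u_c0 : c0_bounded u) (u1 : forall k, 1 <= `|u k|).

Lemma diag_notin_coord_ideal (S : set nat) (F : set (set nat)) :
  (forall K, exists2 i, (K < i)%N & S i) ->
  (forall Q, F Q -> exists K, forall i, (K < i)%N -> S i -> ~ Q i) ->
  ~ coord_ideal iota (windows @` F) (diag iota u (windows S)).
Proof.
move=> Sinf SF [_ /(_ (1 / 2))[|m [D [V [C [DF bV C0 VC]]]]]]; first by lra.
have C1 : 0 < 2 * (C + 1) by rewrite mulr_gt0 // ltr_wpDl.
(* [C * d + 1 / 2 < 1 <= |u n|]: the coordinates of the [V j e_n] cannot all be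
   below [d]. *)
pose d : R := (2 * (C + 1))^-1; have d0 : 0 < d by rewrite invr_gt0.
have Cd : C * d < 1 / 2.
  by rewrite /d ltr_pdivrMr //; lra.
have peak n : (0 < n)%N -> windows S n -> exists jk : nat * nat,
    [/\ (jk.1 < m)%N, D jk.1 jk.2 & d < `|coord iota jk.2 (V jk.1 (basis iota n))|].
  move=> n0 Sn; apply: contrapT => nP.
  have := VC (basis iota n) d (ltW d0); rewrite (diag_basis HX u_c0) // => h.
  have := u1 n; have := ler_norm_basis n0.
  have {h} : `|u n| <= C * d + 1 / 2 * `|basis iota n|; last by lra.
  apply: h => j k jm Dk; rewrite leNgt; apply/negP => dk.
  by apply: nP; exists (j, k).
have /choice[K KP] : forall j, exists K, forall i, (K < i)%N -> S i ->
    forall k, D j k -> (0 < k)%N /\ ~~ (p i < k <= p i.+1)%N.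
  move=> j; have [[Q FQ <-]|->] := DF j.
    have [K KQ] := SF Q FQ; exists K => i Ki Si k [i' Qi' ki']; split; first by lia.
    apply/negP => ki; apply: (KQ i Ki Si).
    by rewrite (window_uniq (block_sequence_lt bs) ki ki').
  exists 0%N => i i0 _ k ->; split=> //.
  by have := increasing_ge_id i (block_sequence_lt bs); lia.
have [M M0 VM] := common_bound m bV.
pose b := Num.trunc (m%:R * M / d).
(* Beyond [b], the bound of [block_mass_lt] falls below [d]. *)
have [i iK Si] := Sinf (maxn b (\max_(j < m) K j)).
have [_ EP [_ _ _ v1 _]] := bs i.
have wS n : n \in E i -> windows S n by move=> /EP nE; exists i.
have n_gt0 n : n \in E i -> (0 < n)%N by move=> /EP; lia.
have /choice[jk jkP] : forall n, exists jk : nat * nat, n \in E i ->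
    [/\ (jk.1 < m)%N, D jk.1 jk.2 & d < `|coord iota jk.2 (V jk.1 (basis iota n))|].
  move=> n; have [nE|nE] := boolP (n \in E i); last by exists (0, 0)%N.
  by have [jk jkn] := peak n (n_gt0 n nE) (wS n nE); exists jk.
case: m => [|m] in VC VM b iK jkP peak *.
  move: v1; rewrite big_seq big1 => [/eqP|n /jkP[]//]; by rewrite eq_sym oner_eq0.
have : d <= m.+1%:R * M * 2 ^- i.+1.
  apply: (@block_mass_lt m V M d i (fun n => (jk n).1) (fun n => (jk n).2)) => //.
    exact: ltW.
  move=> n /jkP[jm Dk dk].
  have Ki : (K (jk n).1 < i)%N.
    apply: leq_ltn_trans iK; rewrite leq_max; apply/orP; right.
    exact: (@leq_bigmax _ (fun j : 'I_m.+1 => K j) (Ordinal jm)).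
  by have [k0 kw] := KP _ i Ki Si _ Dk; split=> //; exact: ltW.
apply/negP; rewrite -ltNge ltr_pdivrMr ?exprn_gt0 // [ltRHS]mulrC -ltr_pdivrMr //.
apply: lt_le_trans (truncnS_gt _) _; rewrite -natrX ler_nat.
apply: (@leq_trans i.+1); last exact/ltnW/ltn_expl.
by rewrite ltnS; apply: leq_trans (ltnW iK); rewrite leq_max leqnn.
Qed.

End Separation.

(** * An almost disjoint family indexed by the reals *)

Section AlmostDisjoint.
Context {R : realType}.
Implicit Types r s : R.

(** The graphs of [n |-> floor (n r)] and [n |-> floor (n s)] separate as soon as
    [n |r - s| >= 1]. *)
Definition graph_code r (n : nat) : nat := choice.pickle (n, Num.floor (n%:R * r)).

Lemma graph_code_inj r s m n : graph_code r m = graph_code s n ->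
  m = n /\ Num.floor (m%:R * r) = Num.floor (m%:R * s).
Proof. by move/(pcan_inj choice.pickleK) => -[-> ->]. Qed.

Lemma graph_code_unbounded r K : exists2 i, (K < i)%N & range (graph_code r) i.
Proof.
have [|n Kn] := @injective_gtn (graph_code r) _ K.
  by move=> m n /graph_code_inj[].
by exists (graph_code r n) => //; exists n.
Qed.

Lemma graph_code_almost_disjoint r s : r != s -> exists K, forall i, (K < i)%N ->
  range (graph_code r) i -> ~ range (graph_code s) i.
Proof.
move=> rs; have d0 : 0 < `|r - s| by rewrite normr_gt0 subr_eq0.
pose B := (Num.trunc `|r - s|^-1).+1.
exists (\max_(n < B) graph_code r n) => i + [n _ ni]; rewrite -ni => Kn [m _ mn].
have [nm fnm] := graph_code_inj (esym mn); move: Kn; apply/negP; rewrite -leqNgt.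
have nB : (n < B)%N.
  rewrite -(ltr_nat R); apply: lt_trans (truncnS_gt _).
  rewrite -[ltRHS]mul1r ltr_pdivlMr //.
  have [/andP[h1 h2] /andP[h3 h4]] := (floor_itv (n%:R * r), floor_itv (n%:R * s)).
  rewrite -[n%:R](ger0_norm (ler0n R n)) -normrM mulrBr ltr_norml.
  move: h1 h2 h3 h4; rewrite fnm !intrD; lra.
exact: (@leq_bigmax _ (fun j : 'I_B => graph_code r j) (Ordinal nB)).
Qed.

End AlmostDisjoint.

(** * Cardinality of the set of ideals *)

Section Cardinals.
Context {R : realType}.

Lemma card_le_inj T U (A : set T) (f : T -> U) :
  {in A &, injective f} -> A #<= [set: U].
Proof.
move=> finj; apply: card_le_trans (card_leT (f @` A)).
by have /card_eqPle[] := inj_card_eq finj.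
Qed.

(** In base 3 with digits 0 and 1, the tail after the first difference cannot make
    up for it, so subsets of [nat] are coded by reals injectively. *)
Definition ternary_sum (A : set nat) n : R := \sum_(k < n) (nat_of_ord k \in A)%:R * 3 ^- k.

Definition ternary (A : set nat) : R := sup (range (ternary_sum A)).

Lemma ternary_sum_tail (A : set nat) m n :
  ternary_sum A n <= ternary_sum A m + 3 / 2 * 3 ^- m.
Proof.
have tS k : ternary_sum A k.+1 = ternary_sum A k + (k \in A)%:R * 3 ^- k.
  by rewrite /ternary_sum big_ord_recr.
have p0 k : 0 < 3 ^- k :> R by rewrite invr_gt0 exprn_gt0.
have pS k : 3 ^- k = 3 * 3 ^- k.+1 :> R.
  by rewrite exprS invfM mulrA divff ?mul1r // pnatr_eq0.
have [mn|nm] := leqP m n.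
  rewrite -(subnKC mn); set d := (n - m)%N.
  suff : ternary_sum A (m + d) + 3 / 2 * 3 ^- (m + d) <=
      ternary_sum A m + 3 / 2 * 3 ^- m.
    by have := p0 (m + d)%N; lra.
  elim: d => [|d IH]; first by rewrite addn0.
  apply: le_trans IH; rewrite addnS tS (pS (m + d)%N).
  have := p0 (m + d).+1; case: (_ \in _) => /=; rewrite ?mul1r ?mul0r; lra.
suff : ternary_sum A n <= ternary_sum A m by have := p0 m; lra.
rewrite -(subnKC (ltnW nm)); elim: (m - n)%N => [|d IH]; first by rewrite addn0.
by rewrite addnS tS (le_trans IH) // lerDl mulr_ge0 // ltW.
Qed.

Lemma ternary_ge (A : set nat) n : ternary_sum A n <= ternary A.
Proof.
apply: ub_le_sup; last by exists n.
by eexists => _ [m _ <-]; exact: (ternary_sum_tail A 0).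
Qed.

Lemma ternary_le (A : set nat) n : ternary A <= ternary_sum A n + 3 / 2 * 3 ^- n.
Proof.
apply: sup_le_ub; first by exists (ternary_sum A 0); exists 0%N.
by move=> _ [m _ <-]; exact: ternary_sum_tail.
Qed.

Lemma ternary_first_difference (A B : set nat) m : (forall k, (k < m)%N -> A k <-> B k) ->
  A m -> ~ B m -> ternary B < ternary A.
Proof.
move=> AB Am Bm; apply: le_lt_trans (ternary_le B m.+1) _.
apply: lt_le_trans (ternary_ge A m.+1).
rewrite /ternary_sum !big_ord_recr /= (mem_set Am) (memNset Bm) mul0r addr0 mul1r.
rewrite (eq_bigr (fun k : 'I_m => (nat_of_ord k \in A)%:R * 3 ^- k)); last first.
  by move=> k _; congr (_%:R * _); congr nat_of_bool; apply/idP/idP;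
    rewrite !inE => /(AB k (ltn_ord k)).
rewrite ltrD2l exprS invfM mulrA -[ltRHS]mul1r ltr_pM2r ?invr_gt0 ?exprn_gt0 //.
by lra.
Qed.

Lemma ternary_inj : injective ternary.
Proof.
move=> A B tAB; apply: contrapT => AB.
have [m [mP mmin]] : exists m, ~ (A m <-> B m) /\ forall k, (k < m)%N -> A k <-> B k.
  have ex : exists m, `[< ~ (A m <-> B m) >].
    apply: contrapT => nm; apply: AB; apply/funext => m; apply/propext.
    by apply: contrapT => mP; apply: nm; exists m; apply/asboolP.
  case: (ex_minnP ex) => m /asboolP mP mmin; exists m; split=> // k km.
  by apply: contrapT => /asboolP/mmin; rewrite leqNgt km.
have [Am|Am] := pselect (A m).
  have Bm : ~ B m by move=> Bm; apply: mP.
  by have := ternary_first_difference mmin Am Bm; rewrite tAB ltxx.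
have Bm : B m by apply: contrapT => Bm; apply: mP.
have mmin' k (km : (k < m)%N) : B k <-> A k by have [? ?] := mmin k km; split.
by have := ternary_first_difference mmin' Bm Am; rewrite tAB ltxx.
Qed.

Lemma dedekind_eq (x y : R) : (forall q : rat, x < ratr q <-> y < ratr q) -> x = y.
Proof.
move=> xy; have [xy'|xy'|//] := ltgtP x y.
  have [q] := rat_in_itvoo xy'; rewrite in_itv /= => /andP[/xy yq qy].
  by have := lt_trans yq qy; rewrite ltxx.
have [q] := rat_in_itvoo xy'; rewrite in_itv /= => /andP[/xy yq qy].
by have := lt_trans yq qy; rewrite ltxx.
Qed.

End Cardinals.

Section OperatorCode.
Context {R : realType} {N : nat} {X : completeNormedModType R}.
Context {iota : (nat -> R) -> X} (HX : is_schreier_space N iota).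

Lemma bounded_operator_ext (S T : X -> X) : bounded_operator S -> bounded_operator T ->
  (forall n, (0 < n)%N -> S (basis iota n) = T (basis iota n)) -> S = T.
Proof.
move=> bS bT ST; apply/funext => x; apply/eqP; rewrite -subr_eq0 -normr_le0.
have [M M0 SM] := bounded_operator_gt0 bS; have [K K0 TK] := bounded_operator_gt0 bT.
apply/ler_addgt0Pl => e e0; rewrite addr0.
have MK : 0 < M + K by rewrite addr_gt0.
have e1 : 0 < e / (M + K) by rewrite divr_gt0.
have [y cy xy] := iota_dense HX x e1.
have [E0 yE0] := c00_support cy; pose E := (E0 `\ 0%N)%fset.
have yE n : n \notin E -> y n = 0.
  by rewrite !inE negb_and negbK => /orP[/eqP->|/yE0//]; exact: cy.1.
have E_gt0 n : n \in E -> (0 < n)%N by rewrite !inE lt0n => /andP[].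
have Sy : S (iota y) = T (iota y).
  rewrite (iota_basis HX cy yE E_gt0) (lin_op_sum _ _ _ bS.1) (lin_op_sum _ _ _ bT.1).
  rewrite big_seq [RHS]big_seq; apply: eq_bigr => n /E_gt0 n0.
  by rewrite (lin_opZ _ _ bS.1) (lin_opZ _ _ bT.1) ST.
have -> : S x - T x = S (x - iota y) - T (x - iota y).
  by rewrite (lin_opB _ _ bS.1) (lin_opB _ _ bT.1) Sy opprB addrA subrK.
apply: le_trans (ler_normB _ _) _.
apply: (@le_trans _ _ ((M + K) * `|x - iota y|)); first by rewrite mulrDl lerD.
by rewrite mulrC -ler_pdivlMr // ltW.
Qed.

(** The Dedekind cuts of all the entries [f_k (T e_n)]. *)
Definition operator_code (T : X -> X) : set nat := [set c | exists n k (q : rat),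
  c = choice.pickle (n, k, q) /\ coord iota k (T (basis iota n)) < ratr q].

Lemma operator_code_inj :
  {in [set T : X -> X | bounded_operator T] &, injective operator_code}.
Proof.
move=> S T /set_mem/= bS /set_mem/= bT ST; apply: bounded_operator_ext => // n _.
apply/eqP; rewrite -subr_eq0; apply/eqP; apply: (coord_total HX) => k.
rewrite (coordB HX); apply/eqP; rewrite subr_eq0; apply/eqP.
have half (A B : X -> X) (q : rat) : operator_code A = operator_code B ->
    coord iota k (A (basis iota n)) < ratr q -> coord iota k (B (basis iota n)) < ratr q.
  move=> AB Aq; have : operator_code A (choice.pickle (n, k, q)) by exists n, k, q.
  by rewrite AB => -[n' [k' [q' [/(pcan_inj choice.pickleK)[-> -> ->]]]]].
by apply: dedekind_eq => q; split; apply: half.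
Qed.

Lemma card_operator_sets :
  [set J : set (X -> X) | J `<=` bounded_operator (X:=X)] #<= [set: set R].
Proof.
apply: (@card_le_inj _ _ _ (fun J => (fun T => ternary (operator_code T) : R) @` J)).
have sub J J' : J `<=` bounded_operator (X:=X) -> J' `<=` bounded_operator (X:=X) ->
    (fun T => ternary (operator_code T) : R) @` J `<=`
    (fun T => ternary (operator_code T) : R) @` J' -> J `<=` J'.
  move=> bJ bJ' JJ T JT; have [|S J'S /ternary_inj ST] := JJ (ternary (operator_code T)).
    by exists T.
  by rewrite -(operator_code_inj _ _ ST) // inE; [exact: bJ'|exact: bJ].
move=> J J' /set_mem bJ /set_mem bJ' JJ'.
by apply/seteqP; split; apply: sub => //; rewrite JJ'.
Qed.

End OperatorCode.

(** A copy of [B] on the positive half-line and a copy of its complement on the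
    negative one: inclusion of such sets forces equality. *)
Definition exp_split {R : realType} (B : set R) : set R :=
  [set x | (0 < x /\ B (ln x)) \/ (x < 0 /\ ~ B (ln (- x)))].

Lemma exp_split_antichain {R : realType} (A B : set R) :
  exp_split A `<=` exp_split B -> A = B.
Proof.
move=> AB; apply/seteqP; split=> x.
  move=> Ax; have : exp_split A (expR x) by left; rewrite expRK expR_gt0.
  case/AB => -[]; first by rewrite expRK.
  by rewrite ltNge expR_ge0.
move=> Bx; apply: contrapT => Ax.
have : exp_split A (- expR x) by right; rewrite opprK expRK oppr_lt0 expR_gt0.
case/AB => -[]; first by rewrite oppr_gt0 ltNge expR_ge0.
by rewrite opprK expRK.
Qed.

Theorem theorem4p4 (R : realType) (N : nat) (X : completeNormedModType R)
    (iota : (nat -> R) -> X) :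
  (1 <= N)%N -> is_schreier_space N iota ->
  [/\ exists I : set R -> set (X -> X),
        (forall A : set R, small_closed_ideal (I A)) /\
        (forall A B : set R, I A `<=` I B <-> A `<=` B),
      [set J : set (X -> X) | small_closed_ideal J] #= [set: set R],
      exists C : set (set (X -> X)),
        [/\ forall J, C J -> small_closed_ideal J,
            incl_chain C
          & C #= [set: R]]
    & exists D : set (set (X -> X)),
        [/\ forall J, D J -> small_closed_ideal J,
            incl_antichain D
          & D #= [set: set R]]].
Proof.
move=> N0 HX; have [u u_c0 u1] := c0_sequence_exists HX N0.
have [p [E [v bs]]] := @block_sequences R N.
pose I (A : set R) := coord_ideal iota
  ((windows (p:=p)) @` ((fun r : R => range (graph_code r)) @` A)).
have I_small A : small_closed_ideal (I A) by exact: (coord_ideal_small HX N0).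
have I_sub A B : I A `<=` I B <-> A `<=` B.
  split=> [IAB s As|AB]; last by apply: coord_ideal_sub; do 2!apply: image_subset.
  apply: contrapT => Bs.
  have := diag_notin_coord_ideal HX N0 bs u_c0 u1 (graph_code_unbounded s).
  move=> /(_ ((fun r : R => range (graph_code r)) @` B)); apply.
    move=> _ [r Br <-]; apply: graph_code_almost_disjoint.
    by apply: contra_notN Bs => /eqP ->.
  apply: IAB; apply: (diag_coord_ideal HX u_c0).
  by exists (range (graph_code s)) => //; exists s.
have I_inj : injective I.
  by move=> A B IAB; apply/seteqP; split; apply/I_sub; rewrite IAB.
split.
- by exists I.
- apply/card_eqPle; split.
    apply: card_le_trans (card_operator_sets HX); apply: subset_card_le.
    by move=> J [[Jbounded _ _ _] _ _]; exact: Jbounded.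
  apply: (@card_le_trans _ _ _ (range I)).
    have /card_eqPle[//] : range I #= [set: set R].
    by apply: inj_card_eq => A B _ _; exact: I_inj.
  by apply: subset_card_le => _ [A _ <-]; exact: I_small.
- exists (range (fun t => I [set x | x < t])); split.
  + by move=> _ [t _ <-]; exact: I_small.
  + move=> _ _ [t _ <-] [t' _ <-].
    have [tt'|/ltW tt'] := leP t t'; [left|right]; apply/I_sub => x /= xt.
      exact: lt_le_trans xt tt'.
    exact: lt_le_trans xt tt'.
  + apply: inj_card_eq => t t' _ _ /I_inj/seteqP[h1 h2].
    have [tt'|tt'|//] := ltgtP t t'.
      by have := h2 t tt'; rewrite /= ltxx.
    by have := h1 t' tt'; rewrite /= ltxx.
- exists (range (fun B => I (exp_split B))); split.
  + by move=> _ [B _ <-]; exact: I_small.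
  + by move=> _ _ [A _ <-] [B _ <-] /I_sub/exp_split_antichain ->.
  + apply: inj_card_eq => A B _ _ /I_inj AB.
    by apply: exp_split_antichain; rewrite AB.
Qed.
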